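(* Let $a,b,c,m$ be positive integers with $a<b\leq c$ and $\gcd(b-a,c-a)=1$. Then there exists a positive integer $N$ such that every integer $n\geq N$ can be written as $n=x+y+z$ with $x,y,z$ positive integers such that $ax+by+cz=p^m$ for some prime number $p$. *)

(* Defs.v *)
From mathcomp Require Import all_boot.

(* Main.v *)
Require Import Defs.
From mathcomp Require Import all_boot.
From mathcomp Require Import all_order all_algebra.
From mathcomp Require Import all_classical all_reals sequences exp Rstruct.
From mathcomp Require Import ring lra zify.

(** Put d = b - a and e = c - a. Replacing x by n - y - z turns the equation into
    p^m - a n = d y + e z, and since d and e are coprime every integer in
    (d e, e (n - e)] has the form d y + e z with y, z > 0 and y + z < n. So one
    needs, for every lam > 1 and all large x, a prime between x and lam x.

    This follows from Selberg's formula
      psi(x) ln x + sum_(n <= x) Lambda(n) psi(x/n) = 2 x ln x + O(x)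
    (proved by the method of Tatuzawa and Iseki) by an argument of Erdos.
    The formula gives psi(v) - psi(u) <= 2 (v - u) + o(v). Suppose that
    liminf (psi(lam x) - psi(x)) / x = 0 and that lam cannot be enlarged much.
    Comparing the formula at x and lam x, for x on the bad sequence, shows that
    psi(lam t) - psi(t) ~ 2 (lam - 1) t for t = x/n and most prime powers n. Since
    every interval (y, lam' y] with lam' slightly above lam contains such n, the
    intervals (t, lam t] cover almost all of a long range, on which Lambda would
    thus have density almost 2. This contradicts Mertens' estimate
    sum_(n <= x) Lambda(n)/n = ln x + O(1). *)

Set Implicit Arguments.
Unset Strict Implicit.
Unset Printing Implicit Defensive.
Import Order.TTheory GRing.Theory Num.Theory.

(** * Divisor sums of the Moebius and von Mangoldt functions *)

Section ArithmeticFunctions.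
Local Open Scope ring_scope.
Variable R : realType.
Implicit Types (n m d k p : nat).

Definition moebius n : R :=
  if all (fun p => logn p n == 1%N) (primes n) then (-1) ^+ size (primes n)
  else 0.

Definition mangoldt n : R :=
  if size (primes n) == 1%N then ln (pdiv n)%:R else 0.

Lemma normr_moebius_le1 n : `|moebius n| <= 1.
Proof. by rewrite /moebius; case: ifP => _; rewrite ?normrX ?normrN1 ?expr1n ?normr0. Qed.

Lemma mangoldt_ge0 n : 0 <= mangoldt n.
Proof.
rewrite /mangoldt; case: ifP => // _; apply: ln_ge0.
by rewrite ler1n pdiv_gt0.
Qed.

Lemma moebius_mul_dvd p d : prime p -> (0 < d)%N -> (p %| d)%N ->
  moebius (p * d) = 0.
Proof.
move=> pp d0 pd; rewrite /moebius ifF //; apply/allP => /(_ p).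
rewrite mem_primes pp muln_gt0 prime_gt0 // d0 dvdn_mulr // => /(_ isT).
have p0 := prime_gt0 pp; rewrite lognM // (logn_prime _ pp) eqxx add1n eqSS.
by rewrite -leqn0 leqNgt logn_gt0 mem_primes pp d0 pd.
Qed.

Lemma moebius_mul_ndvd p d : prime p -> (0 < d)%N -> ~~ (p %| d)%N ->
  moebius (p * d) = - moebius d.
Proof.
move=> pp d0 pd.
have p0 := prime_gt0 pp.
have pr : perm_eq (primes (p * d)) (p :: primes d).
  apply: uniq_perm; rewrite /= ?primes_uniq ?mem_primes ?(negbTE pd) ?andbF //.
  by move=> q; rewrite in_cons primesM // primes_prime // inE.
have e1 q : logn q (p * d) = ((q == p) + logn q d)%N.
  by rewrite lognM // logn_prime.
rewrite /moebius (perm_all _ pr) (perm_size pr) /= e1 eqxx.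
have -> : logn p d = 0%N.
  by apply/eqP; rewrite -leqn0 leqNgt logn_gt0 mem_primes pp d0 (negbTE pd).
rewrite addn0 eqxx /=.
rewrite (@eq_in_all _ _ (fun q => logn q d == 1%N)); last first.
  move=> q; rewrite mem_primes => /and3P[_ _ qd]; rewrite e1.
  by case: (q =P p) => [qp|_]//; rewrite -qp qd in pd.
by case: ifP => _; rewrite ?oppr0 // exprS mulN1r.
Qed.

(** The divisors that are multiples of [p] are the [p * d] with [d] dividing [k]. Those with [p]
    dividing [d] contribute 0, and the others cancel against the divisors of [k] prime to [p]. *)
Lemma sum_divisors_mul_moebius p k : prime p -> (0 < k)%N ->
  \sum_(d <- divisors (p * k)) moebius d = 0.
Proof.
move=> pp k0; have p0 := prime_gt0 pp; have pk0 : (0 < p * k)%N by rewrite muln_gt0 p0.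
rewrite (bigID (fun d => p %| d)%N) /=.
have -> : \sum_(d <- divisors (p * k) | (p %| d)%N) moebius d =
          \sum_(d <- divisors k) moebius (p * d).
  rewrite -big_filter -(big_map (muln p) xpredT moebius); apply: perm_big.
  apply: uniq_perm; rewrite ?filter_uniq ?divisors_uniq //.
    rewrite map_inj_uniq ?divisors_uniq // => u v /eqP.
    by rewrite eqn_pmul2l // => /eqP.
  move=> d; rewrite mem_filter -dvdn_divisors //.
  apply/andP/mapP => [[/dvdnP[e ->]]|[e ed ->]].
    by rewrite mulnC dvdn_pmul2l // => ek; exists e => //; rewrite -dvdn_divisors.
  by rewrite dvdn_mulr // dvdn_pmul2l // -dvdn_divisors in ed *.
rewrite (bigID (fun d => p %| d)%N) /= big1_seq ?add0r; last first.
  move=> d /andP[pd]; rewrite -dvdn_divisors // => dk.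
  by rewrite moebius_mul_dvd // (dvdn_gt0 k0).
have -> : \sum_(d <- divisors (p * k) | ~~ (p %| d)%N) moebius d =
          \sum_(d <- divisors k | ~~ (p %| d)%N) moebius d.
  rewrite -big_filter -[RHS]big_filter; apply: perm_big.
  apply: uniq_perm; rewrite ?filter_uniq ?divisors_uniq //.
  move=> d; rewrite !mem_filter -!dvdn_divisors //.
  by case pd: (p %| d)%N => //=; rewrite Gauss_dvdr // coprime_sym prime_coprime // pd.
rewrite -big_split big1_seq //= => d /andP[pd]; rewrite -dvdn_divisors // => dk.
by rewrite moebius_mul_ndvd // ?(dvdn_gt0 k0) // addNr.
Qed.

Lemma sum_divisors_moebius n : (0 < n)%N ->
  \sum_(d <- divisors n) moebius d = (n == 1%N)%:R.
Proof.
move=> n0; case: eqP => [->|/eqP n1].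
  by rewrite (_ : divisors 1 = [:: 1%N]) // big_seq1 /moebius.
have np : (1 < n)%N by rewrite ltn_neqAle eq_sym n1.
have /dvdnP[k nk] := pdiv_dvd n; rewrite nk mulnC.
by rewrite sum_divisors_mul_moebius ?pdiv_prime //; case: k nk n0 => // ->.
Qed.

Lemma mangoldt_pfactor p k : prime p -> (0 < k)%N -> mangoldt (p ^ k) = ln p%:R.
Proof.
move=> pp; case: k => // k _.
by rewrite /mangoldt pdiv_pfactor // primesX // primes_prime.
Qed.

Lemma mangoldt_neq0 n : mangoldt n != 0 ->
  exists p k, [/\ prime p, (0 < k)%N & n = (p ^ k)%N].
Proof.
rewrite /mangoldt; case: ifP; last by rewrite eqxx.
case E: (primes n) => [//|p [|//]] _ _.
have : p \in primes n by rewrite E inE.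
rewrite mem_primes => /and3P[pp n0 pn].
have : p.-nat n by rewrite /pnat n0 E /= inE eqxx.
case/p_natP => -[|k] nk; last by exists p, k.+1.
by move: E; rewrite nk.
Qed.

(** Strip one prime: n = k p. A divisor of n that does not divide k contains the full power of [p],
    so [p ^ v] is the only prime power among them and adds ln p to the inductive value ln k. *)
Lemma sum_divisors_mangoldt n : (0 < n)%N ->
  \sum_(d <- divisors n) mangoldt d = ln n%:R.
Proof.
elim/ltn_ind: n => n IH n0.
have [n1|n1] := leqP n 1.
  have -> : n = 1%N by apply/eqP; rewrite eqn_leq n1.
  by rewrite (_ : divisors 1 = [:: 1%N]) // big_seq1 /mangoldt ln1.
have pp := pdiv_prime n1; have p0 := prime_gt0 pp; have p1 := prime_gt1 pp.
move: pp p0 p1; have /dvdnP[k] := pdiv_dvd n.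
set p := pdiv n; move=> nk pp p0 p1.
have k0 : (0 < k)%N by case: k nk n0 => // ->.
have kn : (k < n)%N by rewrite nk ltn_Pmulr.
rewrite {1}nk (bigID (fun d => d %| k)%N) /=.
have -> : \sum_(d <- divisors (k * p) | (d %| k)%N) mangoldt d =
          \sum_(d <- divisors k) mangoldt d.
  rewrite -big_filter; apply: perm_big.
  apply: uniq_perm; rewrite ?filter_uniq ?divisors_uniq //.
  move=> d; rewrite !mem_filter -!dvdn_divisors ?muln_gt0 ?k0 //.
  by case dk: (d %| k)%N => //=; rewrite dvdn_mulr.
rewrite IH // nk natrM lnM ?posrE ?ltr0n //; congr (_ + _).
set v := (logn p k).+1.
have lk q : logn q (k * p) = (logn q k + (q == p))%N.
  by rewrite lognM // [in X in (_ + X)%N]logn_prime.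
have pvk : ~~ (p ^ v %| k)%N by rewrite pfactor_dvdn // -ltnNge.
have pvkp : (p ^ v)%N \in divisors (k * p).
  rewrite -dvdn_divisors ?muln_gt0 ?k0 // pfactor_dvdn ?muln_gt0 ?k0 //.
  by rewrite lk eqxx addn1.
rewrite -big_filter (bigD1_seq (p ^ v)%N) ?filter_uniq ?divisors_uniq //=; last first.
  by rewrite mem_filter pvk.
rewrite big_filter_cond big1_seq ?addr0 ?mangoldt_pfactor //.
move=> d /andP[/andP[ndk ndv]]; rewrite -dvdn_divisors ?muln_gt0 ?k0 // => dkp.
apply/eqP; apply/negPn/negP => /mangoldt_neq0[q [j [qp j0 dE]]].
move: ndk dkp ndv; rewrite dE !pfactor_dvdn ?muln_gt0 ?k0 // lk -ltnNge.
case: eqP => [->|_]; last by rewrite addn0 => h; rewrite leqNgt h.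
by rewrite addn1 => h1 h2; rewrite /v eqn_exp2l // eqn_leq h1 h2.
Qed.

Lemma sum_dvd_divisors N n (F : nat -> R) : (0 < n <= N)%N ->
  \sum_(1 <= d < N.+1 | (d %| n)%N) F d = \sum_(d <- divisors n) F d.
Proof.
move=> /andP[n0 nN]; rewrite -big_filter; apply: perm_big.
apply: uniq_perm; rewrite ?filter_uniq ?iota_uniq ?divisors_uniq // => d.
rewrite mem_filter mem_index_iota -dvdn_divisors // ltnS.
case dn: (d %| n)%N => //=.
by rewrite (dvdn_gt0 n0) // (leq_trans _ nN) // dvdn_leq.
Qed.

Lemma sum_multiples N d (F : nat -> R) : (0 < d)%N ->
  \sum_(1 <= m < N.+1 | (d %| m)%N) F m = \sum_(1 <= k < (N %/ d).+1) F (d * k)%N.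
Proof.
move=> d0; elim: N => [|N IH]; first by rewrite div0n !big_geq.
rewrite big_mkcond big_nat_recr //= -big_mkcond IH divnS //.
case dN: (d %| N.+1)%N; last by rewrite addr0 add0n.
rewrite -[(true + _)%N]/((N %/ d).+1) [in RHS]big_nat_recr //=; congr (_ + _); congr F.
by have := divnS N d0; rewrite dN add1n => <-; rewrite mulnC divnK.
Qed.

(** Turns the range depending on [d] into a condition symmetric in [d] and [k], so that double sums
    can be exchanged. *)
Lemma sum_divn_cond N d (F : nat -> R) : (0 < d)%N ->
  \sum_(1 <= k < (N %/ d).+1) F k = \sum_(1 <= k < N.+1 | (d * k <= N)%N) F k.
Proof.
move=> d0; rewrite [RHS](big_cat_nat (n := (N %/ d).+1)) //= ?ltnS ?leq_div //.
rewrite [X in _ + X]big_nat_cond [X in _ + X]big1 ?addr0; last first.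
  by move=> k /andP[/andP[k1 _]]; rewrite mulnC -leq_divRL // leqNgt k1.
rewrite big_nat_cond [RHS]big_nat_cond.
apply: eq_bigl => k; rewrite andbT ltnS leq_divRL // mulnC.
by case: (d * k <= N)%N; rewrite ?andbF ?andbT.
Qed.

Lemma sum_hyperbola N (F : nat -> nat -> R) :
  \sum_(1 <= d < N.+1) \sum_(1 <= k < (N %/ d).+1) F d k =
  \sum_(1 <= k < N.+1) \sum_(1 <= d < (N %/ k).+1) F d k.
Proof.
rewrite big_nat [RHS]big_nat.
under eq_bigr => d /andP[d0 _] do rewrite sum_divn_cond //.
under [RHS]eq_bigr => d /andP[d0 _] do rewrite sum_divn_cond //.
rewrite -!big_nat.
rewrite (exchange_big_dep_nat xpredT) //=.
by under eq_bigr => k _ do under eq_bigl => d do rewrite mulnC.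
Qed.

Lemma sum_sum_dvd N (F G : nat -> R) :
  \sum_(1 <= m < N.+1) F m * \sum_(1 <= d < N.+1 | (d %| m)%N) G d =
  \sum_(1 <= d < N.+1) G d * \sum_(1 <= k < (N %/ d).+1) F (d * k)%N.
Proof.
under eq_bigr do rewrite mulr_sumr.
rewrite (exchange_big_dep_nat xpredT) //=.
rewrite big_nat [RHS]big_nat; apply: eq_bigr => d /andP[d0 _].
rewrite (sum_multiples _ (fun m => F m * G d)) // mulr_sumr.
by apply: eq_bigr => k _; rewrite mulrC.
Qed.

(** The inner sum vanishes unless n / e = 1, so only e = n survives. *)
Lemma mangoldt_moebius n : (0 < n)%N ->
  \sum_(1 <= e < n.+1 | (e %| n)%N)
      mangoldt e * \sum_(1 <= d < n.+1 | (d %| n %/ e)%N) moebius d = mangoldt n.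
Proof.
move=> n0.
rewrite big_mkcond (bigD1_seq n) ?iota_uniq ?mem_index_iota ?n0 ?ltnS ?leqnn //=.
rewrite dvdnn divnn n0 sum_dvd_divisors // (_ : divisors 1 = [:: 1%N]) // big_seq1.
rewrite big1_seq; first by rewrite /moebius addr0 expr0 mulr1.
move=> e /andP[nen]; rewrite mem_index_iota => /andP[e0 _].
case: ifP => // en.
have ne0 : (0 < n %/ e)%N by rewrite divn_gt0 // dvdn_leq.
rewrite sum_dvd_divisors ?ne0 ?(leq_trans (leq_div _ _)) //.
rewrite sum_divisors_moebius //.
case: eqP => [h|_]; last by rewrite mulr0.
by rewrite -(divnK en) h mul1n eqxx in nen.
Qed.

Lemma dvdn_div_sym n d e : (0 < d)%N -> (0 < e)%N -> (e %| n)%N ->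
  (d %| n)%N && (e %| n %/ d)%N = (d %| n %/ e)%N.
Proof.
move=> d0 e0 en; apply/andP/idP => [[dn]|h].
  by rewrite -(dvdn_pmul2r d0) divnK // mulnC -{1}(divnK en) dvdn_pmul2r.
have dn : (d %| n)%N by rewrite (dvdn_trans h) // dvdn_div.
by split => //; rewrite -(dvdn_pmul2r d0) divnK // mulnC -(divnK en) dvdn_pmul2r.
Qed.

(** Expanding ln (n / d) as a divisor sum of [mangoldt] and exchanging the sums gives [key]. The
    part with ln n then drops out: its factor is 0 unless n = 1, where ln n = 0. *)
Lemma sum_divisors_moebius_ln n : (0 < n)%N ->
  \sum_(d <- divisors n) moebius d * ln d%:R = - mangoldt n.
Proof.
move=> n0.
have key : \sum_(1 <= d < n.+1 | (d %| n)%N) moebius d * (ln n%:R - ln d%:R)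
    = mangoldt n.
  rewrite -[RHS]mangoldt_moebius //.
  under [RHS]eq_bigr do rewrite mulr_sumr.
  rewrite (exchange_big_dep_nat (fun d => d %| n)%N) /=; last first.
    by move=> e d _ _ en den; rewrite (dvdn_trans den) // dvdn_div.
  rewrite big_nat_cond [RHS]big_nat_cond; apply: eq_bigr => d /andP[/andP[d0 _] dn].
  have nd0 : (0 < n %/ d)%N by rewrite divn_gt0 // dvdn_leq.
  rewrite -mulr_suml mulrC; congr (_ * _).
  transitivity (\sum_(1 <= e < n.+1 | (e %| n %/ d)%N) mangoldt e).
    rewrite sum_dvd_divisors ?nd0 ?leq_div // sum_divisors_mangoldt //.
    rewrite -[in LHS](divnK dn) natrM lnM ?posrE ?ltr0n //; lra.
  rewrite big_nat_cond [RHS]big_nat_cond; apply: eq_bigl => e.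
  case e0: (0 < e)%N => //=; congr (_ && _).
  by rewrite -dvdn_div_sym.
have := key; rewrite sum_dvd_divisors ?n0 ?leqnn //.
under eq_bigr do rewrite mulrBr.
rewrite sumrB -mulr_suml sum_divisors_moebius // => <-.
by case: eqP => [->|_]; rewrite ?ln1 ?mul0r ?mulr0 sub0r opprK.
Qed.

(* The Tatuzawa-Iseki identity, for f m = F(N / m). *)
Lemma moebius_ln_sum N (f : nat -> R) : (0 < N)%N ->
  \sum_(1 <= d < N.+1) moebius d * ln (N%:R / d%:R) *
     \sum_(1 <= k < (N %/ d).+1) f (d * k)%N =
  f 1%N * ln N%:R + \sum_(1 <= m < N.+1) mangoldt m * f m.
Proof.
move=> N0; rewrite -(sum_sum_dvd N f (fun d => moebius d * ln (N%:R / d%:R))).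
(* As ln (N / d) = ln N - ln d, the inner divisor sum is ln N times the indicator of m = 1, plus
   Lambda(m). *)
have E m : (0 < m < N.+1)%N ->
   f m * (\sum_(1 <= d < N.+1 | (d %| m)%N) moebius d * ln (N%:R / d%:R)) =
   f m * (ln N%:R * (m == 1%N)%:R) + mangoldt m * f m.
  rewrite ltnS => mN; have /andP[m0 _] := mN.
  rewrite -[m in RHS]/(id m) /= [mangoldt m * _]mulrC -mulrDr; congr (_ * _).
  rewrite sum_dvd_divisors // big_seq.
  rewrite (eq_bigr (fun d => moebius d * ln N%:R - moebius d * ln d%:R)); last first.
    move=> d; rewrite -dvdn_divisors // => dm; have d0 := dvdn_gt0 m0 dm.
    by rewrite ln_div ?posrE ?ltr0n // mulrBr.
  rewrite -big_seq sumrB -mulr_suml sum_divisors_moebius // sum_divisors_moebius_ln //.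
  by rewrite opprK mulrC.
rewrite big_nat; under eq_bigr => m mN do rewrite E //.
rewrite -big_nat big_split /=; congr (_ + _).
rewrite big_ltn // eqxx mulr1 big_nat_cond big1 ?addr0 //.
by move=> m /andP[/andP[m1 _] _]; rewrite gtn_eqF // !mulr0.
Qed.

End ArithmeticFunctions.

(** * Logarithm inequalities, weak Stirling bounds and Euler's constant *)

Section LogEstimates.
Local Open Scope ring_scope.
Variable R : realType.
Implicit Types (x y : R) (n : nat).

Lemma ln_le_subr1 x : 0 < x -> ln x <= x - 1.
Proof. by move=> x0; rewrite -{1}(subrKC 1 x) le_ln1Dx //; lra. Qed.

Lemma ln_ge_1subrV x : 0 < x -> 1 - x^-1 <= ln x.
Proof.
move=> x0; have := @ln_le_subr1 x^-1; rewrite invr_gt0 lnV ?posrE // => /(_ x0).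
lra.
Qed.

Lemma ln_le_sqrt x : 1 <= x -> ln x <= 2 * Num.sqrt x.
Proof.
move=> x1; have s0 : 0 < Num.sqrt x by rewrite sqrtr_gt0; lra.
have {1}-> : x = Num.sqrt x * Num.sqrt x by rewrite -expr2 sqr_sqrtr //; lra.
rewrite lnM ?posrE //; have := ln_le_subr1 s0; lra.
Qed.

Lemma ln_le_sqrt_sqrt x : 1 <= x -> ln x <= 4 * Num.sqrt (Num.sqrt x).
Proof.
move=> x1; set s := Num.sqrt x.
have s1 : 1 <= s by rewrite -(@sqrtr1 R) ler_wsqrtr.
have xs : x = s * s by rewrite -expr2 sqr_sqrtr //; lra.
by rewrite xs lnM ?posrE; [have := ln_le_sqrt s1|..]; lra.
Qed.

(** Used at x = N / d in Selberg's formula, because sqrt (N / d) sums over d to O(N). With [t] the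
    fourth root of x, ln x <= 4 t, and 48 = 16 + 32. *)
Lemma ln_sqr_le_sqrt x : 1 <= x -> ln x * (4 + 2 * ln x) <= 48 * Num.sqrt x.
Proof.
move=> x1; set s := Num.sqrt x.
have s1 : 1 <= s by rewrite -(@sqrtr1 R) ler_wsqrtr.
set t := Num.sqrt s.
have t1 : 1 <= t by rewrite -(@sqrtr1 R) ler_wsqrtr.
have st : s = t * t by rewrite -expr2 sqr_sqrtr //; lra.
have ln4 : ln x <= 4 * t := ln_le_sqrt_sqrt x1.
have ln0 := ln_ge0 x1.
have h1 : ln x * (4 + 2 * ln x) <= (4 * t) * (4 + 2 * (4 * t)).
  by apply: ler_pM; lra.
by apply: (le_trans h1); rewrite st; nra.
Qed.

(** For consecutive roots a < b, 1 = (b - a) (b + a) <= 2 b (b - a), so 1 / b <= 2 (b - a), and the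
    bound telescopes. *)
Lemma sum_invr_sqrt_le n :
  \sum_(1 <= k < n.+1) (Num.sqrt k%:R)^-1 <= 2 * Num.sqrt n%:R :> R.
Proof.
elim: n => [|n IH]; first by rewrite big_geq // mulr_ge0 ?sqrtr_ge0.
rewrite big_nat_recr //=; apply: (le_trans (lerD IH (lexx _))).
set a := Num.sqrt n%:R; set b := Num.sqrt n.+1%:R.
have a0 : 0 <= a by rewrite sqrtr_ge0.
have b0 : 0 < b by rewrite sqrtr_gt0 ltr0n.
have ab : b * b = a * a + 1.
  by rewrite -!expr2 !sqr_sqrtr ?ler0n // -natr1.
rewrite -(ler_pM2r b0) mulrDl mulVf ?gt_eqF //.
have := sqr_ge0 (b - a); rewrite expr2; nra.
Qed.

Definition ln_fact n : R := \sum_(1 <= k < n.+1) ln k%:R.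

Definition harmonic_sum n : R := \sum_(1 <= k < n.+1) k%:R^-1.

Lemma ln_succ_sub_itv n : (0 < n)%N ->
  (n.+1%:R^-1 : R) <= ln (n.+1%:R : R) - ln n%:R <= n%:R^-1.
Proof.
move=> n0; have n0' : (0 : R) < n%:R by rewrite ltr0n.
have n1' : (0 : R) < n.+1%:R by rewrite ltr0n.
have q0 : (0 : R) < n.+1%:R / n%:R by rewrite divr_gt0.
rewrite -ln_div ?posrE //; apply/andP; split.
  apply: le_trans (ln_ge_1subrV q0); rewrite invf_div -natr1.
  by rewrite le_eqVlt; apply/orP; left; apply/eqP; field; rewrite natr1 pnatr_eq0.
apply: (le_trans (ln_le_subr1 q0)); rewrite -natr1.
by rewrite le_eqVlt; apply/orP; left; apply/eqP; field; rewrite gt_eqF.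
Qed.

Lemma ln_fact_bounds n : (0 < n)%N ->
  n%:R * ln n%:R - n%:R <= ln_fact n <= n%:R * ln n%:R - n%:R + 1 + ln n%:R.
Proof.
elim: n => // -[_ _|n IH _].
  by rewrite /ln_fact big_nat1 ln1; apply/andP; split; lra.
have /andP[h1 h2] := IH isT.
have := @ln_succ_sub_itv n.+1 isT => /andP[h3 h4].
rewrite /ln_fact big_nat_recr //= -/(ln_fact n.+1).
have n1 : (0 : R) < n.+1%:R by rewrite ltr0n.
have e : n.+2%:R = n.+1%:R + 1 :> R by rewrite natr1.
set a : R := n.+1%:R in h1 h2 h3 h4 n1 e *; set b : R := n.+2%:R in h1 h2 h3 h4 e *.
set la := ln a in h1 h2 h3 h4 *; set lb := ln b in h1 h2 h3 h4 *.
have k1 : a * (lb - la) <= 1.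
  by rewrite -(mulfV (lt0r_neq0 n1)) ler_pM2l.
have b0 : 0 < b by lra.
have k2 : 1 <= b * (lb - la).
  by rewrite -(mulfV (lt0r_neq0 b0)) ler_pM2l.
by apply/andP; split; rewrite e in k2 *; nra.
Qed.

(** [a n] decreases and a n - 1 / n increases, so both enclose the supremum of the latter, the
    Euler-Mascheroni constant. *)
Lemma euler_constant : exists g : R, 0 <= g <= 1 /\
  forall n, (0 < n)%N -> `|harmonic_sum n - ln n%:R - g| <= n%:R^-1.
Proof.
pose a n := harmonic_sum n - ln n%:R.
have rec n : harmonic_sum n.+1 = harmonic_sum n + n.+1%:R^-1.
  by rewrite /harmonic_sum big_nat_recr.
have stepd n : (0 < n)%N -> a n.+1 <= a n.
  move=> n0; have /andP[h1 h2] := ln_succ_sub_itv n0; rewrite /a rec.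
  by move: h1 h2; set u := _^-1; lra.
have stepi n : (0 < n)%N -> a n - n%:R^-1 <= a n.+1 - n.+1%:R^-1.
  move=> n0; have /andP[h1 h2] := ln_succ_sub_itv n0; rewrite /a rec.
  by move: h1 h2; set u := _.+1%:R^-1; lra.
have dec n k : (0 < n)%N -> a (n + k)%N <= a n.
  move=> n0; elim: k => [|k IH]; first by rewrite addn0.
  by rewrite addnS; apply: le_trans IH; rewrite stepd // addn_gt0 n0.
have inc n k : (0 < n)%N -> a n - n%:R^-1 <= a (n + k)%N - (n + k)%:R^-1.
  move=> n0; elim: k => [|k IH]; first by rewrite addn0.
  by rewrite addnS; apply: (le_trans IH); rewrite stepi // addn_gt0 n0.
have cross n m : (0 < n)%N -> (0 < m)%N -> a n - n%:R^-1 <= a m.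
  move=> n0 m0; apply: (le_trans (inc n m n0)).
  apply: (le_trans _ (dec m n m0)); rewrite addnC.
  by rewrite lerBlDr lerDl invr_ge0 ler0n.
pose S := [set z | exists2 n, (0 < n)%N & z = a n - n%:R^-1]%classic.
have S0 : (S !=set0)%classic by exists (a 1%N - 1%:R^-1), 1%N.
have ubS m : (0 < m)%N -> ubound S (a m).
  by move=> m0 z [n n0 ->]; exact: cross.
have bS n : (0 < n)%N -> a n - n%:R^-1 <= sup S <= a n.
  move=> n0; apply/andP; split; last by apply: ge_sup => //; exact: ubS.
  by apply: ub_le_sup; [exists (a 1%N); exact: ubS|exists n].
have a1 : a 1%N = 1 by rewrite /a /harmonic_sum big_nat1 ln1; lra.
exists (sup S); split.
  by have := bS 1%N isT; rewrite a1 invr1 subrr.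
move=> n n0; have /andP[h1 h2] := bS n n0.
by rewrite -/(a n) ger0_norm; lra.
Qed.

End LogEstimates.

(** * Bounds of Chebyshev and Mertens; Selberg's formula at integers *)

Section Chebyshev.
Local Open Scope ring_scope.
Variable R : realType.
Implicit Types (n N d k : nat).

Definition psi_nat n : R := \sum_(1 <= i < n.+1) mangoldt R i.

Definition mertens_sum n : R := \sum_(1 <= i < n.+1) mangoldt R i / i%:R.

Lemma psi_nat_ge0 n : 0 <= psi_nat n.
Proof. by apply: sumr_ge0 => i _; exact: mangoldt_ge0. Qed.

Lemma ln_fact_mangoldt N :
  ln_fact R N = \sum_(1 <= d < N.+1) mangoldt R d * (N %/ d)%:R.
Proof.
transitivity (\sum_(1 <= m < N.+1) 1 * \sum_(1 <= d < N.+1 | (d %| m)%N) mangoldt R d).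
  rewrite /ln_fact big_nat [RHS]big_nat; apply: eq_bigr => m mN.
  by rewrite mul1r sum_dvd_divisors // sum_divisors_mangoldt //; case/andP: mN.
rewrite sum_sum_dvd; apply: eq_bigr => d _; congr (_ * _).
by rewrite sumr_const_nat subn1.
Qed.

Lemma ln_fact_psi_nat N : ln_fact R N = \sum_(1 <= k < N.+1) psi_nat (N %/ k).
Proof.
rewrite ln_fact_mangoldt /psi_nat -sum_hyperbola; apply: eq_bigr => d _.
by rewrite sumr_const_nat subn1 mulr_natr.
Qed.

(** By [ln_fact_mangoldt], Lambda(d) has on the right the coefficient floor(N / d) - 2 floor(N / (2
    d)), which is nonnegative, and at least 1 when N / 2 < d <= N. *)
Lemma psi_nat_sub_half N : psi_nat N - psi_nat (N %/ 2) <= ln_fact R N - 2 * ln_fact R (N %/ 2).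
Proof.
rewrite !ln_fact_mangoldt.
have h : ((N %/ 2).+1 <= N.+1)%N by rewrite ltnS leq_div.
rewrite /psi_nat (big_cat_nat (n := (N %/ 2).+1)) //= addrAC subrr add0r.
rewrite [X in _ <= X - _](big_cat_nat (n := (N %/ 2).+1)) //= mulr_sumr addrAC -sumrB.
rewrite -[leLHS]add0r; apply: lerD.
  apply: sumr_ge0 => d _.
  have -> : mangoldt R d * (N %/ d)%:R - 2 * (mangoldt R d * (N %/ 2 %/ d)%:R) =
     mangoldt R d * ((N %/ d)%:R - 2 * (N %/ 2 %/ d)%:R) by ring.
  rewrite mulr_ge0 ?mangoldt_ge0 // subr_ge0 divnAC mulrC -natrM ler_nat.
  exact: leq_trunc_div.
rewrite big_nat [leRHS]big_nat; apply: ler_sum => d /andP[d1 d2].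
rewrite ler_peMr ?mangoldt_ge0 // ler1n divn_gt0 //.
by case: d d1 d2.
Qed.

(** Halving induction: the weak Stirling bounds make the increment from [m] to [N] linear in N. The
    total comes to at most 13 m + 2 N, which is below 10 N. *)
Lemma psi_nat_le N : psi_nat N <= 10 * N%:R.
Proof.
elim/ltn_ind: N => N IH.
have [N1|N2] := ltnP N 2.
  apply: (le_trans (y := 0)); last by rewrite mulr_ge0.
  rewrite /psi_nat big_nat big1 // => i; rewrite ltnS => /andP[i0 iN].
  have -> : i = 1%N by apply/eqP; rewrite eqn_leq i0 (leq_trans iN).
  by rewrite /mangoldt.
set m := (N %/ 2)%N.
have m0 : (0 < m)%N by rewrite divn_gt0.
have mN : (m < N)%N by rewrite ltn_Pdiv // (leq_trans _ N2).
have N0 : (0 < N)%N by rewrite (leq_trans _ N2).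
have e1 : (m * 2 <= N)%N by exact: leq_trunc_div.
have e2 : (N <= m * 2 + 1)%N by rewrite /m; lia.
have := psi_nat_sub_half N; rewrite -/m.
have /andP[a1 a2] := ln_fact_bounds R N0.
have /andP[b1 b2] := ln_fact_bounds R m0.
have := IH m mN.
have M0 : (1 : R) <= m%:R by rewrite ler1n.
have E1 : m%:R * 2 <= N%:R :> R by rewrite -natrM ler_nat.
have E2 : N%:R <= m%:R * 2 + 1 :> R by rewrite -natrM natr1 ler_nat -addn1.
set x : R := N%:R in a1 a2 b1 b2 E1 E2 *; set y : R := m%:R in a1 a2 b1 b2 M0 E1 E2 *.
have x0 : 0 < x by lra.
have y0 : 0 < y by lra.
have l1 : ln x - ln y <= 2.
  rewrite -ln_div ?posrE //.
  have q0 : 0 < x / y by rewrite divr_gt0.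
  apply: (le_trans (ln_le_subr1 q0)); rewrite lerBlDr ler_pdivrMr //; lra.
have l2 := ln_le_subr1 x0; have l3 := ln_le_subr1 y0.
have l0 : 0 <= ln y by rewrite ln_ge0.
have k1 : x * ln x - 2 * (y * ln y) <= 2 * x + ln y.
  have : (x - y * 2) * ln y <= 1 * ln y by rewrite ler_wpM2r //; lra.
  have : x * (ln x - ln y) <= x * 2 by rewrite ler_pM2l.
  lra.
lra.
Qed.

(** N times the Mertens sum exceeds [ln_fact] by the fractional parts of N / d weighted by
    Lambda(d), hence by an amount between 0 and psi(N). *)
Lemma mertens_bounds N : (0 < N)%N ->
  ln N%:R - 1 <= mertens_sum N <= ln N%:R + 11.
Proof.
move=> N0; have N0' : (0 : R) < N%:R by rewrite ltr0n.
have /andP[a1 a2] := ln_fact_bounds R N0.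
have E : N%:R * mertens_sum N = \sum_(1 <= d < N.+1) mangoldt R d * (N%:R / d%:R).
  by rewrite mulr_sumr; apply: eq_bigr => d _; ring.
have l1 : ln_fact R N <= N%:R * mertens_sum N.
  rewrite E ln_fact_mangoldt big_nat [leRHS]big_nat; apply: ler_sum => d /andP[d0 _].
  by rewrite ler_wpM2l ?mangoldt_ge0 // ler_pdivlMr ?ltr0n // -natrM ler_nat leq_trunc_div.
have l2 : N%:R * mertens_sum N <= ln_fact R N + psi_nat N.
  rewrite E ln_fact_mangoldt -big_split [leLHS]big_nat [leRHS]big_nat /=.
  apply: ler_sum => d /andP[d0 _].
  rewrite -[X in _ + X]mulr1 -mulrDr ler_wpM2l ?mangoldt_ge0 //.
  by rewrite ler_pdivrMr ?ltr0n // natr1 -natrM ler_nat ltnW // ltn_ceil.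
have l3 := psi_nat_le N; have l4 := ln_le_subr1 N0'.
by apply/andP; split; rewrite -(ler_pM2l N0'); nra.
Qed.

(** In [moebius_ln_sum] for the [f] below, the right side is the Selberg expression up to O(N): one
    N ln N comes from [f 1], the other from the Mertens sum. The left side is O(N) termwise. The
    constant is 129 = 96 + 11 + 22, for the left side, the Mertens error and the terms in g + 1. *)
Lemma selberg_nat N : (0 < N)%N ->
  `|psi_nat N * ln N%:R + \sum_(1 <= m < N.+1) mangoldt R m * psi_nat (N %/ m)
    - 2 * (N%:R * ln N%:R)| <= 129 * N%:R.
Proof.
move=> N0; have [g [/andP[g0 g1] Hg]] := euler_constant R.
have N0' : (1 : R) <= N%:R by rewrite ler1n.
(* f m = F(N / m) with F(x) = psi(x) - x + (g + 1), for which sum_k F(x / k) = O(ln x). *)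
pose f m : R := psi_nat (N %/ m) - N%:R / m%:R + (g + 1).
have := moebius_ln_sum f N0.
set L := (X in X = _); set T := (X in _ = X) => LT.
have : `|L| <= 96 * N%:R.
  apply: (le_trans (ler_norm_sum _ _ _)).
  apply: (@le_trans _ _ (\sum_(1 <= d < N.+1) 48 * Num.sqrt N%:R * (Num.sqrt d%:R)^-1)).
    rewrite big_nat [leRHS]big_nat; apply: ler_sum => d; rewrite ltnS => /andP[d0 dN].
    have q0 : (0 < N %/ d)%N by rewrite divn_gt0.
    have D0 : (0 : R) < d%:R by rewrite ltr0n.
    set y := N%:R / d%:R; set q := (N %/ d)%N in q0 *.
    have -> : \sum_(1 <= k < q.+1) f (d * k)%N =
        ln_fact R q - y * harmonic_sum R q + (g + 1) * q%:R.
      rewrite ln_fact_psi_nat /harmonic_sum mulr_sumr /f big_split /= sumrB.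
      rewrite sumr_const_nat subn1 mulr_natr; congr (_ - _ + _).
        by apply: eq_bigr => k _; rewrite divnMA.
      by apply: eq_bigr => k _; rewrite natrM invfM mulrA.
    have Q0 : (1 : R) <= q%:R by rewrite ler1n.
    have yq : q%:R <= y by rewrite ler_pdivlMr // -natrM ler_nat leq_trunc_div.
    have yq1 : y <= q%:R + 1.
      by rewrite ler_pdivrMr // natr1 -natrM ler_nat ltnW // ltn_ceil.
    have /andP[a1 a2] := ln_fact_bounds R q0.
    have := Hg q q0; set e := _ - _ - g => he.
    have lq : 0 <= ln q%:R :> R by rewrite ln_ge0.
    have lqy : ln q%:R <= ln y by rewrite ler_ln ?posrE //; lra.
    rewrite !normrM; apply: (@le_trans _ _ (1 * `|ln y| * (4 + 2 * ln y))).
      rewrite ler_pM ?mulr_ge0 ?normr_ge0 ?ler_wpM2r ?normr_moebius_le1 //.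
      (* The constant g + 1 in [f] makes the linear terms - q, - y g and (g + 1) q collapse to g (q
         - y). Each remaining summand is O(1 + ln y). *)
      have -> : ln_fact R q - y * harmonic_sum R q + (g + 1) * q%:R =
         (ln_fact R q - (q%:R * ln q%:R - q%:R)) + (q%:R - y) * ln q%:R - y * e + g * (q%:R - y).
        rewrite /e; ring.
      have ye : `|y * e| <= 2.
        rewrite normrM ger0_norm; last lra.
        apply: (@le_trans _ _ (y * q%:R^-1)); first by rewrite ler_wpM2l //; lra.
        by rewrite ler_pdivrMr; lra.
      move: ye; rewrite !ler_norml => /andP[y1 y2].
      have z1 : - ln q%:R <= (q%:R - y) * ln q%:R <= 0 by apply/andP; split; nra.
      have z2 : - 1 <= g * (q%:R - y) <= 0 by apply/andP; split; nra.
      by case/andP: z1 => ? ?; case/andP: z2 => ? ?; apply/andP; split; lra.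
    have y1 : 1 <= y by lra.
    rewrite mul1r ger0_norm ?ln_ge0 //; apply: (le_trans (ln_sqr_le_sqrt y1)).
    by rewrite /y sqrtrM ?ler0n // sqrtrV ?ler0n // mulrA.
  rewrite -mulr_sumr.
  have := sum_invr_sqrt_le R N.
  rewrite -(ler_pM2l (_ : 0 < 48 * Num.sqrt N%:R :> R)); last first.
    by rewrite mulr_gt0 // sqrtr_gt0; lra.
  move=> /le_trans; apply.
  have : Num.sqrt N%:R * Num.sqrt N%:R = N%:R :> R by rewrite -expr2 sqr_sqrtr ?ler0n.
  by move=> e; rewrite -[in X in _ <= X]e; lra.
rewrite LT /T.
have -> : \sum_(1 <= m < N.+1) mangoldt R m * f m =
   \sum_(1 <= m < N.+1) mangoldt R m * psi_nat (N %/ m) - N%:R * mertens_sum N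
   + (g + 1) * psi_nat N.
  rewrite /mertens_sum /psi_nat !mulr_sumr -sumrB -big_split.
  by apply: eq_bigr => m _; rewrite /f /psi_nat /=; ring.
rewrite {1}/f divn1 divr1 !ler_norml => /andP[u1 u2].
have /andP[v1 v2] := mertens_bounds N0.
have w := psi_nat_le N; have w0 := psi_nat_ge0 N.
have l1 : ln N%:R <= N%:R :> R by have := @ln_le_subr1 R N%:R; lra.
have l0 : 0 <= ln N%:R :> R by rewrite ln_ge0.
have k1 : N%:R * ln N%:R - N%:R <= N%:R * mertens_sum N <= N%:R * ln N%:R + 11 * N%:R.
  by apply/andP; split; nra.
have k2 : 0 <= (g + 1) * (ln N%:R + psi_nat N) <= 22 * N%:R.
  by apply/andP; split; nra.
case/andP: k1 => ? ?; case/andP: k2 => ? ?.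
apply/andP; split; lra.
Qed.

End Chebyshev.

(** * Selberg's formula at real arguments and its first consequences *)

Section RealVariable.
Local Open Scope ring_scope.
Variable R : realType.
Implicit Types (x y u v t : R) (n m k : nat).

Local Notation Lam := (mangoldt R).

Definition psi x := psi_nat R (Num.truncn x).

Definition mertens x := mertens_sum R (Num.truncn x).

(** Open on the left and closed on the right, so that adjacent intervals concatenate without
    counting a term twice. *)
Definition sum_itv u v (F : nat -> R) :=
  \sum_((Num.truncn u).+1 <= n < (Num.truncn v).+1) F n.

Lemma mem_sum_itv u v n : 0 <= u -> 0 <= v ->
  ((Num.truncn u).+1 <= n < (Num.truncn v).+1)%N = (u < n%:R <= v).
Proof. by move=> u0 v0; rewrite truncn_lt_nat // ltnS truncn_ge_nat. Qed.

Lemma sum_itv_split u v w (F : nat -> R) : u <= v -> v <= w ->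
  sum_itv u w F = sum_itv u v F + sum_itv v w F.
Proof.
move=> uv vw; rewrite /sum_itv (big_cat_nat (n := (Num.truncn v).+1)) //=.
  by rewrite ltnS le_truncn.
by rewrite ltnS le_truncn.
Qed.

Lemma ler_sum_itv u v (F G : nat -> R) : 0 <= u -> 0 <= v ->
  (forall n, u < n%:R <= v -> F n <= G n) -> sum_itv u v F <= sum_itv u v G.
Proof.
move=> u0 v0 FG; rewrite /sum_itv big_nat [leRHS]big_nat; apply: ler_sum => n.
by rewrite mem_sum_itv //; exact: FG.
Qed.

Lemma sum_itv_ge0 u v (F : nat -> R) : 0 <= u -> 0 <= v ->
  (forall n, u < n%:R <= v -> 0 <= F n) -> 0 <= sum_itv u v F.
Proof.
move=> u0 v0 F0; rewrite /sum_itv big_nat; apply: sumr_ge0 => n.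
by rewrite mem_sum_itv //; exact: F0.
Qed.

Lemma psi_sub u v : u <= v -> psi v - psi u = sum_itv u v Lam.
Proof.
move=> uv; rewrite /psi /psi_nat /sum_itv.
rewrite (big_cat_nat (n := (Num.truncn u).+1)) //= ?ltnS ?le_truncn //.
by rewrite addrAC subrr add0r.
Qed.

Lemma mertens_sub u v : u <= v ->
  mertens v - mertens u = sum_itv u v (fun n => Lam n / n%:R).
Proof.
move=> uv; rewrite /mertens /mertens_sum /sum_itv.
rewrite (big_cat_nat (n := (Num.truncn u).+1)) //= ?ltnS ?le_truncn //.
by rewrite addrAC subrr add0r.
Qed.

Lemma psi_ge0 x : 0 <= psi x. Proof. exact: psi_nat_ge0. Qed.

Lemma psi_le u v : u <= v -> psi u <= psi v.
Proof.
move=> uv; rewrite -subr_ge0 psi_sub //.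
by apply: sumr_ge0 => n _; exact: mangoldt_ge0.
Qed.

Lemma psi_lt1 x : x < 1 -> psi x = 0.
Proof.
move=> x1; rewrite /psi (_ : Num.truncn x = 0%N) /psi_nat ?big_geq //.
by apply/truncn0Pn; rewrite -ltNge.
Qed.

Lemma psi_le_linear x : 0 <= x -> psi x <= 10 * x.
Proof.
move=> x0; apply: (le_trans (psi_nat_le _ _)).
by rewrite ler_pM2l // truncn_le.
Qed.

Lemma mertens_sub_le u v : 0 < u -> u <= v -> mertens v - mertens u <= (psi v - psi u) / u.
Proof.
move=> u0 uv; rewrite mertens_sub // psi_sub // /sum_itv mulr_suml.
apply: ler_sum_itv; [lra|lra|move=> n /andP[un _]].
by rewrite ler_wpM2l ?mangoldt_ge0 // lef_pV2 ?posrE; lra.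
Qed.

Lemma mertens_sub_ge u v : 0 < u -> u <= v -> (psi v - psi u) / v <= mertens v - mertens u.
Proof.
move=> u0 uv; rewrite mertens_sub // psi_sub // /sum_itv mulr_suml.
apply: ler_sum_itv; [lra|lra|move=> n /andP[un nv]].
by rewrite ler_wpM2l ?mangoldt_ge0 // lef_pV2 ?posrE; lra.
Qed.

Lemma truncn_bounds x : 1 <= x ->
  [/\ (0 < Num.truncn x)%N, (1 : R) <= (Num.truncn x)%:R, (Num.truncn x)%:R <= x,
      x <= (Num.truncn x)%:R + 1 &
      [/\ 0 <= ln ((Num.truncn x)%:R : R), ln ((Num.truncn x)%:R : R) <= ln x &
      (Num.truncn x)%:R * (ln x - ln (Num.truncn x)%:R) <= 1]].
Proof.
move=> x1; have n0 : (0 < Num.truncn x)%N by rewrite truncn_gt0.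
have n1 : (1 : R) <= (Num.truncn x)%:R by rewrite ler1n.
have /andP[nx xn] : (Num.truncn x)%:R <= x < (Num.truncn x).+1%:R.
  by apply: truncn_itv; lra.
rewrite -natr1 in xn.
split; [by []|by []|by []|lra|].
split; [by rewrite ln_ge0|by rewrite ler_ln ?posrE; lra|].
set N : R := (Num.truncn x)%:R in n1 nx xn *.
have N0 : 0 < N by lra.
rewrite -ln_div ?posrE; try lra.
have q0 : 0 < x / N by rewrite divr_gt0 //; lra.
have := ln_le_subr1 q0; rewrite -(ler_pM2l N0) mulrBr mulrCA mulfV ?gt_eqF //; lra.
Qed.

Lemma mertens_bounds_real x : 1 <= x -> ln x - 2 <= mertens x <= ln x + 11.
Proof.
move=> x1; have [n0 n1 _ _ [l0 l1 l2]] := truncn_bounds x1.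
have /andP[h1 h2] := mertens_bounds R n0; rewrite /mertens.
set N : R := (Num.truncn x)%:R in n1 l0 l1 l2 h1 h2 *.
have k : ln x - ln N <= 1 by apply: le_trans l2; rewrite ler_peMl; lra.
by apply/andP; split; lra.
Qed.

Lemma truncn_divn x n : 0 <= x -> (0 < n)%N ->
  Num.truncn (x / n%:R) = (Num.truncn x %/ n)%N.
Proof.
move=> x0 n0; have n0' : (0 : R) < n%:R by rewrite ltr0n.
have /andP[h1 h2] := truncn_itv x0.
apply: truncn_def; rewrite ler_pdivlMr // ltr_pdivrMr // -!natrM.
rewrite (le_trans _ h1) ?ler_nat ?leq_trunc_div //=.
by apply: (lt_le_trans h2); rewrite ler_nat ltn_ceil.
Qed.

(** The upper limit is kept free, since terms with m > x vanish: sums at two arguments can then be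
    compared over one range. *)
Definition selberg_sum x Z := \sum_(1 <= m < Z.+1) Lam m * psi (x / m%:R).

Lemma selberg_sum_widen x Z : 0 <= x -> (Num.truncn x <= Z)%N ->
  selberg_sum x Z = \sum_(1 <= m < (Num.truncn x).+1) Lam m * psi_nat R (Num.truncn x %/ m).
Proof.
move=> x0 xZ; rewrite /selberg_sum (big_cat_nat (n := (Num.truncn x).+1)) //=.
rewrite [X in _ + X]big_nat [X in _ + X]big1 ?addr0 => [|m /andP[m1 _]].
  rewrite big_nat [RHS]big_nat; apply: eq_bigr => m /andP[m0 _].
  by rewrite /psi truncn_divn.
have m0 : (0 : R) < m%:R by rewrite ltr0n (leq_trans _ m1).
by rewrite psi_lt1 ?mulr0 // ltr_pdivrMr // mul1r -truncn_lt_nat.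
Qed.

Lemma selberg x Z : 1 <= x -> (Num.truncn x <= Z)%N ->
  `|psi x * ln x + selberg_sum x Z - 2 * (x * ln x)| <= 150 * x.
Proof.
move=> x1 xZ; have x0 : 0 <= x by lra.
rewrite selberg_sum_widen //.
have [n0 n1 nx xn [l0 l1 l2]] := truncn_bounds x1.
have := selberg_nat R n0; have := psi_nat_le R (Num.truncn x).
have := psi_nat_ge0 R (Num.truncn x); rewrite -/(psi x).
set N : R := (Num.truncn x)%:R in n1 nx xn l0 l1 l2 *; set S := \sum_(_ <= _ < _) _.
move=> p0 p1; rewrite !ler_norml => /andP[h1 h2].
have lx : ln x <= x - 1 by apply: ln_le_subr1; lra.
have k1 : 0 <= psi x * (ln x - ln N) <= 10.
  apply/andP; split; first by rewrite mulr_ge0 //; lra.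
  have : psi x * (ln x - ln N) <= 10 * N * (ln x - ln N) by rewrite ler_wpM2r //; lra.
  lra.
have k2 : 0 <= x * ln x - N * ln N <= x + 1.
  have -> : x * ln x - N * ln N = (x - N) * ln x + N * (ln x - ln N) by ring.
  have : 0 <= (x - N) * ln x by rewrite mulr_ge0 //; lra.
  have : (x - N) * ln x <= 1 * ln x by rewrite ler_wpM2r //; lra.
  have : 0 <= N * (ln x - ln N) by rewrite mulr_ge0 //; lra.
  by move=> *; apply/andP; split; lra.
case/andP: k1 => ? ?; case/andP: k2 => ? ?.
by apply/andP; split; lra.
Qed.

Lemma selberg_sum_mono u v Z : u <= v -> selberg_sum u Z <= selberg_sum v Z.
Proof.
move=> uv; apply: ler_sum => m _; rewrite ler_wpM2l ?mangoldt_ge0 //.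
by rewrite psi_le // ler_wpM2r // invr_ge0.
Qed.

(** Subtract Selberg's formula at u from that at v. The difference of the two [selberg_sum] is
    nonnegative and is dropped. The constant 302 is 2 * 150, plus 2 from u (ln v - ln u) <= v -
    u. *)
Lemma psi_sub_le u v : 1 <= u -> u <= v ->
  (psi v - psi u) * ln v <= 2 * (v - u) * ln v + 302 * v.
Proof.
move=> u1 uv; have v1 : 1 <= v by lra.
have u0 : 0 < u by lra.
have tuv : (Num.truncn u <= Num.truncn v)%N by exact: le_truncn.
have := selberg u1 tuv; have := selberg v1 (leqnn _).
have := selberg_sum_mono (Num.truncn v) uv.
set Su := selberg_sum u _; set Sv := selberg_sum v _ => s.
rewrite !ler_norml => /andP[a1 a2] /andP[b1 b2].
have lv : ln u <= ln v by rewrite ler_ln ?posrE; lra.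
have k1 : 0 <= psi u * (ln v - ln u) by rewrite mulr_ge0 ?psi_ge0 //; lra.
have k2 : u * (ln v - ln u) <= v - u.
  rewrite -ln_div ?posrE; try lra.
  have q0 : 0 < v / u by rewrite divr_gt0 //; lra.
  have := ln_le_subr1 q0; rewrite -(ler_pM2l u0) mulrBr mulrCA mulfV ?gt_eqF //; lra.
lra.
Qed.

Definition short_interval_bound (eps T : R) :=
  forall u v, T <= u -> u <= v -> psi v - psi u <= 2 * (v - u) + eps * v.

Lemma short_interval_bound_exists (eps : R) : 0 < eps ->
  exists2 T, 1 <= T & short_interval_bound eps T.
Proof.
(* Beyond this point ln v >= 302 / eps, so the error 302 v / ln v of [psi_sub_le] is at most eps
   v. *)
move=> e0; pose T := expR (302 / eps).
have T1 : 1 < T by rewrite expR_gt1 divr_gt0.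
exists T => [|u v Tu uv]; first lra.
have lv : 302 / eps <= ln v.
  by rewrite -[leLHS]expRK ler_ln ?posrE ?expR_gt0 -/T; lra.
have l0 : 0 < ln v by apply: lt_le_trans lv; rewrite divr_gt0.
rewrite -(ler_pM2r l0); apply: (le_trans (psi_sub_le _ uv)); first lra.
rewrite ler_pdivrMr // in lv; nra.
Qed.

Definition defect (lam eps x : R) n :=
  Lam n * ((2 * (lam - 1) + eps) * (x / n%:R) - (psi (lam * (x / n%:R)) - psi (x / n%:R))).

Lemma selberg_increment lam x : 1 < lam -> 1 <= x ->
  2 * (lam - 1) * (x * ln x) - (psi (lam * x) - psi x) * ln x
     - (150 * lam + 150 + 10 * (lam * ln lam)) * x
  <= \sum_(1 <= n < (Num.truncn (lam * x)).+1)
        Lam n * (psi (lam * (x / n%:R)) - psi (x / n%:R)).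
Proof.
move=> lam1 x1; have xl : x <= lam * x by rewrite ler_peMl; lra.
have := selberg x1 (le_truncn xl); have := @selberg (lam * x) _ (le_trans x1 xl) (leqnn _).
have -> : \sum_(1 <= n < (Num.truncn (lam * x)).+1)
        Lam n * (psi (lam * (x / n%:R)) - psi (x / n%:R)) =
   selberg_sum (lam * x) (Num.truncn (lam * x)) - selberg_sum x (Num.truncn (lam * x)).
  by rewrite /selberg_sum -sumrB; apply: eq_bigr => n _; rewrite mulrBr mulrA.
set A := selberg_sum _ _; set B := selberg_sum x _.
rewrite !ler_norml => /andP[a1 a2] /andP[b1 b2].
have p1 : psi (lam * x) <= 10 * (lam * x) by apply: psi_le_linear; lra.
have l0 : 0 < ln lam by rewrite ln_gt0.
have e : ln (lam * x) = ln lam + ln x by rewrite lnM ?posrE; lra.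
rewrite e in a1 a2.
have k1 : psi (lam * x) * ln lam <= 10 * (lam * x) * ln lam by rewrite ler_wpM2r //; lra.
have k2 : 0 <= lam * x * ln lam by rewrite !mulr_ge0 //; lra.
lra.
Qed.

(** When (x, lam x] carries little mass, [selberg_increment] forces the weighted increments over n
    to be almost 2 (lam - 1) x ln x, which by Mertens is nearly their maximum. The three eps come
    from the hypothesis on x, the eps in [defect], and the O(x) terms. *)
Lemma sum_defect_le (lam eps T : R) : 1 < lam -> 0 < eps -> 1 <= T ->
  exists X, forall x, X <= x -> psi (lam * x) - psi x <= eps * x ->
    sum_itv 0 (x / T) (defect lam eps x) <= 3 * eps * (x * ln x).
Proof.
move=> lam1 eps0 T1.
have T0 : 0 < T by lra.
(* [C1] is the error of [selberg_increment], [C2] pays for the n beyond x / T through psi <= 10 lam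
   x / n and Mertens (13 = 11 + 2), and [C3] for the Mertens error in the main term. *)
pose C1 := 150 * lam + 150 + 10 * (lam * ln lam).
pose C2 := 10 * lam * (ln lam + ln T + 13).
pose C3 := (2 * (lam - 1) + eps) * 11.
pose C := C1 + C2 + C3.
exists (T + expR (C / eps)) => x Xx bad.
have ex0 : 0 < expR (C / eps) by exact: expR_gt0.
have x1 : 1 <= x by lra.
have x0 : 0 < x by lra.
have lx : C / eps <= ln x.
  by rewrite -[leLHS]expRK ler_ln ?posrE //; lra.
rewrite ler_pdivrMr // in lx.
have xT1 : 1 <= x / T by rewrite ler_pdivlMr //; lra.
have xTx : x / T <= x by rewrite ler_pdivrMr // ler_peMr //; lra.
have xlx : x <= lam * x by rewrite ler_peMl; lra.
have := selberg_increment lam1 x1; rewrite -/C1.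
set S := \sum_(1 <= n < _) _.
have -> : S = sum_itv 0 (lam * x)
    (fun n => Lam n * (psi (lam * (x / n%:R)) - psi (x / n%:R))).
  by rewrite /S /sum_itv truncn0.
rewrite (@sum_itv_split 0 (x / T)); [|lra|lra].
set h := (fun n => _ : R).
have tail : sum_itv (x / T) (lam * x) h <= C2 * x.
  apply: (@le_trans _ _ (sum_itv (x / T) (lam * x) (fun n => 10 * lam * x * (Lam n / n%:R)))).
    apply: ler_sum_itv; [lra|lra|move=> n /andP[n1 n2]].
    have n0 : (0 : R) < n%:R by lra.
    have xn0 : 0 < x / n%:R by rewrite divr_gt0.
    have -> : 10 * lam * x * (Lam n / n%:R) = Lam n * (10 * (lam * (x / n%:R))) by ring.
    rewrite /h ler_wpM2l ?mangoldt_ge0 //.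
    have := psi_ge0 (x / n%:R); have := @psi_le_linear (lam * (x / n%:R)).
    by rewrite mulr_ge0 //; [move=> /(_ isT); lra|lra|lra].
  rewrite /sum_itv -mulr_sumr -/(sum_itv _ _ _) -mertens_sub; last lra.
  have xT0 : 0 < x / T by lra.
  have /andP[_ m1] := @mertens_bounds_real (lam * x) ltac:(lra).
  have /andP[m2 _] := mertens_bounds_real xT1.
  rewrite lnM ?posrE in m1; [|lra|lra].
  rewrite ln_div ?posrE // in m2.
  have -> : C2 * x = 10 * lam * x * (ln lam + ln T + 13) by rewrite /C2; ring.
  apply: ler_wpM2l; last lra.
  by rewrite !mulr_ge0 //; lra.
have E : sum_itv 0 (x / T) (defect lam eps x) =
   (2 * (lam - 1) + eps) * x * (mertens (x / T) - mertens 0) - sum_itv 0 (x / T) h.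
  rewrite mertens_sub; last lra.
  rewrite /sum_itv mulr_sumr -sumrB; apply: eq_bigr => n _.
  by rewrite /defect /h; ring.
have m0 : mertens 0 = 0 by rewrite /mertens truncn0 /mertens_sum big_geq.
have /andP[_ m1] := mertens_bounds_real xT1.
have lxT : ln (x / T) <= ln x by rewrite ler_ln ?posrE; lra.
have k : (2 * (lam - 1) + eps) * x * (mertens (x / T) - mertens 0)
   <= (2 * (lam - 1) + eps) * x * (ln x + 11).
  by rewrite ler_wpM2l // ?mulr_ge0; lra.
have lx0 : 0 <= ln x by rewrite ln_ge0.
have kb : (psi (lam * x) - psi x) * ln x <= eps * x * ln x by rewrite ler_wpM2r.
have kC : C * x <= ln x * eps * x by rewrite ler_wpM2r //; lra.
rewrite E => main; rewrite /C /C3 in kC; lra.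
Qed.

End RealVariable.

(** * A covering argument on a sequence of cells *)

Section CoveredCells.
Local Open Scope ring_scope.

Lemma sum_nat_eq_le1 (R : numDomainType) a b k :
  \sum_(a <= i < b) (i == k)%:R <= 1 :> R.
Proof.
have [kin|kout] := boolP (k \in index_iota a b).
  by rewrite (bigD1_seq k) ?iota_uniq //= eqxx big1 ?addr0 // => i /negbTE ->.
rewrite big1_seq // => i /andP[_ iin].
by case: eqP iin kout => // -> ->.
Qed.

(** Subtracting [a] at the two exceptional indices costs at most 2 a, whether or not they lie in the
    range. *)
Lemma sum_sparse_exceptions (R : realType) (w : nat -> R) (a : R) s L j : 0 <= a ->
  (forall i, 0 <= w i) ->
  (forall i, (s <= i < s + L)%N -> i != j -> i != j.+1 -> a <= w i) ->
  a * (L%:R - 2) <= \sum_(s <= i < s + L) w i.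
Proof.
move=> a0 w0 H.
have E := sum_nat_eq_le1 R s (s + L).
apply: (@le_trans _ _ (\sum_(s <= i < s + L) (a - a * (i == j)%:R - a * (i == j.+1)%:R))).
  rewrite 2!sumrB sumr_const_nat addKn -!mulr_sumr -[a *+ L]mulr_natr.
  have := ler_wpM2l a0 (E j); have := ler_wpM2l a0 (E j.+1); lra.
rewrite big_nat [leRHS]big_nat; apply: ler_sum => i ib.
case: (i =P j) => [->|/eqP ij].
  apply: le_trans (w0 j).
  by rewrite mulr1 subrr add0r oppr_le0 mulr_ge0.
case: (i =P j.+1) => [->|/eqP ij1]; first by rewrite mulr0 mulr1 subr0 subrr.
by rewrite !mulr0 !subr0; exact: H.
Qed.

(* w i is the mass of the i-th cell of a logarithmic grid and G i says that some
   saturated t lies in that cell, whence (t, lam t] covers the next k - 1 cells.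
   If j is the first uncovered cell of a block, the k + 1 cells that end with
   j + 1 meet G only in j or j + 1; so only these two can be uncovered. *)
Lemma covered_block (R : realType) (w : nat -> R) (a : R) (G : nat -> Prop) k s :
  0 <= a -> (forall i, 0 <= w i) -> (0 < k)%N -> (k <= s)%N ->
  (forall j, (j <= s)%N -> exists i, (j <= i <= j + k)%N /\ G i) ->
  (forall i i', G i -> (i < i' < i + k)%N -> a <= w i') ->
  a * (k%:R - 3) <= \sum_(s <= i < s + k.-1) w i.
Proof.
move=> a0 w0 k0 ks meet cov.
have -> : k%:R - 3 = k.-1%:R - 2 :> R by rewrite -{1}(prednK k0) -natr1; lra.
have [[j0 /andP[j0b j0w]]|noj] :=
    pselect (exists j, (s <= j < s + k.-1)%N && (w j < a)); last first.
  apply: (@sum_sparse_exceptions _ _ _ _ _ 0%N) => // i ib _ _.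
  by rewrite leNgt; apply/negP => wi; apply: noj; exists i; rewrite ib.
have exj : exists j, (s <= j < s + k.-1)%N && (w j < a) by exists j0; rewrite j0b.
case: (ex_minnP exj) => j /andP[/andP[sj jk] wj] jmin.
(* The subtraction does not truncate, because k <= s <= j. *)
have [i [/andP[i1 i2] Gi]] : exists i, (j.+1 - k <= i <= j.+1 - k + k)%N /\ G i.
  by apply: meet; lia.
have ij : (j <= i)%N.
  rewrite leqNgt; apply/negP => ilj.
  by move: wj; rewrite ltNge (cov i j) //; lia.
apply: (@sum_sparse_exceptions _ _ _ _ _ j) => // m mb mj mj1.
have [jm|mlj] := ltnP j m; first by apply: (cov i) => //; lia.
rewrite leNgt; apply/negP => wm.
by have := jmin m; rewrite mb wm => /(_ isT); lia.
Qed.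

Lemma covered_blocks (R : realType) (w : nat -> R) (a : R) (G : nat -> Prop) k r :
  0 <= a -> (forall i, 0 <= w i) -> (0 < k)%N ->
  (forall j, (j <= k + r * k.-1)%N -> exists i, (j <= i <= j + k)%N /\ G i) ->
  (forall i i', G i -> (i < i' < i + k)%N -> a <= w i') ->
  a * (k%:R - 3) * r%:R <= \sum_(k <= i < k + r * k.-1) w i.
Proof.
move=> a0 w0 k0 meet cov; elim: r meet => [|r IH] meet.
  by rewrite mulr0 mul0n addn0 big_geq.
rewrite (big_cat_nat (n := (k + r * k.-1)%N)) //=; [|lia|lia].
rewrite -[r.+1%:R]natr1 mulrDr mulr1; apply: lerD.
  by apply: IH => j jb; apply: meet; lia.
have -> : (k + r.+1 * k.-1)%N = ((k + r * k.-1) + k.-1)%N by lia.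
by apply: (covered_block (G := G)) => //; [lia|move=> j jb; apply: meet; lia].
Qed.

End CoveredCells.

(** * The argument of Erdos: psi grows linearly over (x, lam x] *)

Section Erdos.
Local Open Scope ring_scope.
Variable R : realType.
Implicit Types (x y u v t lam eps : R) (n m k : nat).

Local Notation Lam := (mangoldt R).

(* liminf (psi (lam x) - psi x) / x = 0 as x tends to infinity *)
Definition sparse lam := forall eta X : R, 0 < eta -> exists2 x, X <= x &
  psi (lam * x) - psi x <= eta * x.

Lemma not_sparse lam : ~ sparse lam -> exists delta X : R, [/\ 0 < delta, 1 <= X &
  forall x, X <= x -> delta * x <= psi (lam * x) - psi x].
Proof.
move=> ns; apply: contrapT => H; apply: ns => eta X eta0.
apply: contrapT => H2; apply: H; exists eta, (Num.max 1 X); split => //.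
  by rewrite le_max lexx.
move=> x; rewrite ge_max => /andP[x1 xX]; rewrite leNgt; apply/negP => lt.
by apply: H2; exists x => //; exact: ltW.
Qed.

Lemma sparse_le lam lam' : lam' <= lam -> sparse lam -> sparse lam'.
Proof.
move=> ll sp eta X eta0; have [x xX h] := sp eta (Num.max 0 X) eta0.
move: xX; rewrite ge_max => /andP[x0 xX]; exists x => //.
by apply: le_trans h; rewrite lerB // psi_le // ler_wpM2r.
Qed.

(** By Mertens the sum of Lambda(n) / n over (x, lam x] is at least ln lam - 13 >= 1, so psi grows
    there by at least x. *)
Lemma not_sparse_large lam : 0 < lam -> 14 <= ln lam -> ~ sparse lam.
Proof.
move=> lam0 lam14 sp.
have lam1 : 1 < lam by rewrite -ltr_ln ?posrE // ln1; lra.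
have [x x1 h] := sp (1 / 2) 1 ltac:(lra).
have x0 : 0 < x by lra.
have xl : x <= lam * x by rewrite ler_peMl; lra.
have := mertens_sub_le x0 xl; rewrite ler_pdivlMr // => k.
have /andP[_ m1] := mertens_bounds_real x1.
have /andP[m2 _] := mertens_bounds_real (le_trans x1 xl).
rewrite lnM ?posrE in m2; [|lra|lra].
have : 1 * x <= (mertens (lam * x) - mertens x) * x by rewrite ler_wpM2r; lra.
lra.
Qed.

(* By short_interval_bound, the slope 2 is the largest possible one. *)
Definition saturated lam kappa t := (2 * (lam - 1) - kappa) * t <= psi (lam * t) - psi t.

(** From the growth over (t, lam t] remove the upper bounds for (t, u] and (s u, lam t]; almost the
    full slope 2 is left on (u, s u]. The two errors add up to at most 2 eps lam u. *)
Lemma saturated_cell lam kappa eps T s t u :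
  short_interval_bound eps T -> 1 < s -> 1 < lam -> 0 < eps -> 1 <= T -> 0 <= kappa ->
  saturated lam kappa t -> T <= t -> t <= u -> s * u <= lam * t ->
  (2 * (s - 1) - kappa - 2 * eps * lam) / s <= mertens (s * u) - mertens u.
Proof.
move=> U s1 lam1 e0 T1 k0 sat Tt tu sul.
have u0 : 0 < u by lra.
have su : u <= s * u by rewrite ler_peMl; lra.
apply: le_trans (mertens_sub_ge u0 su).
rewrite ler_pdivlMr ?mulr_gt0 //; last lra.
rewrite mulrA divfK; last by rewrite gt_eqF; lra.
have U1 := U _ _ Tt tu; have U2 := U (s * u) (lam * t) ltac:(lra) sul.
have k1 : eps * u <= eps * (lam * t) by rewrite ler_wpM2l //; lra.
have k2 : eps * (lam * t) <= eps * (lam * u) by rewrite ler_wpM2l ?ler_wpM2l //; lra.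
have k3 : kappa * t <= kappa * u by rewrite ler_wpM2l.
move: sat; rewrite /saturated; lra.
Qed.

(** The slack is eps * lam because the error in [short_interval_bound] is proportional to the right
    endpoint, here lam t. *)
Lemma defect_ge0 lam eps T x n : short_interval_bound eps T -> 1 < lam -> 1 <= T ->
  (0 < n)%N -> T <= x / n%:R -> 0 <= defect lam (eps * lam) x n.
Proof.
move=> U lam1 T1 n0 Tt; rewrite /defect mulr_ge0 ?mangoldt_ge0 //.
set t := x / n%:R in Tt *.
have := U t (lam * t) Tt; rewrite ler_peMl; [|lra|lra] => /(_ isT); lra.
Qed.

(** If no such t were saturated, every prime power n in (y, rho y] would have defect at least
    Lambda(n) kappa x / (rho y). Their total weight is at least delta y, which contradicts
    [small]. *)
Lemma saturated_exists lam kappa eps delta T x y rho : short_interval_bound eps T ->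
  1 < lam -> 1 <= T -> 0 < kappa -> 0 <= eps -> 1 <= y -> 1 < rho ->
  delta * y <= psi (rho * y) - psi y -> T <= x / (rho * y) ->
  sum_itv y (rho * y) (defect lam (eps * lam) x) < kappa * delta / rho * x ->
  exists2 t, x / (rho * y) <= t < x / y & saturated lam kappa t.
Proof.
move=> U lam1 T1 kap0 eps0 y1 rho1 dense Txy small.
have y0 : 0 < y by lra.
have ry0 : 0 < rho * y by rewrite mulr_gt0; lra.
have x0 : 0 < x.
  have : 0 < x / (rho * y) by lra.
  by rewrite pmulr_lgt0 // invr_gt0.
apply: contrapT => H; move: small; apply/negP; rewrite -leNgt.
apply: (@le_trans _ _ (kappa * (x / (rho * y)) * (psi (rho * y) - psi y))).
  have -> : kappa * delta / rho * x = kappa * (x / (rho * y)) * (delta * y).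
    by field; apply/andP; split; rewrite gt_eqF //; lra.
  by apply: ler_wpM2l => //; apply: mulr_ge0; [|apply: divr_ge0]; lra.
rewrite psi_sub; last by rewrite ler_peMl; lra.
rewrite /sum_itv mulr_sumr; apply: ler_sum_itv; [lra|lra|move=> n /andP[yn nr]].
have n0 : (0 : R) < n%:R by lra.
rewrite mulrC /defect ler_wpM2l ?mangoldt_ge0 //.
have xn : x / (rho * y) <= x / n%:R by rewrite ler_wpM2l ?lef_pV2 ?posrE //; lra.
have xn2 : x / n%:R < x / y by rewrite ltr_pM2l // ltf_pV2 ?posrE.
set t := x / n%:R in xn xn2 *.
have nsat : psi (lam * t) - psi t < (2 * (lam - 1) - kappa) * t.
  by rewrite ltNge; apply/negP => sat; apply: H; exists t; rewrite ?xn.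
have k1 : kappa * (x / (rho * y)) <= kappa * t by rewrite ler_pM2l.
have k2 : 0 <= eps * lam * t by apply: mulr_ge0; [apply: mulr_ge0|]; lra.
lra.
Qed.

(** If the defect over the block were smaller, saturated points would occur in every k + 1
    consecutive cells [t0 s^i, t0 s^(i+1)). Their intervals would cover most cells with density
    almost 2, too much for Mertens. *)
Lemma defect_block s k delta X : 1 < s -> s <= 9 / 8 -> (12 <= k)%N -> 0 < delta -> 1 <= X ->
  (forall y, X <= y -> delta * y <= psi (s ^+ k.+1 * y) - psi y) ->
  exists H c eps0 : R, [/\ 1 < H, 0 < c, 0 < eps0 & forall eps T t0 x,
    0 < eps -> eps <= eps0 -> 1 <= T -> short_interval_bound eps T -> T <= t0 ->
    X <= x / (t0 * H) ->
    c * x <= sum_itv (x / (t0 * H)) (x / t0) (defect (s ^+ k) (eps * s ^+ k) x)].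
Proof.
move=> s1 s98 k12 delta0 X1 dense.
have s0 : 0 < s by lra.
have sp n : 0 < s ^+ n by rewrite exprn_gt0.
have sge n : 1 <= s ^+ n by rewrite exprn_ege1 // ltW.
have sgt n : (0 < n)%N -> 1 < s ^+ n by move=> n0; rewrite exprn_egt1 // -lt0n.
set lam := s ^+ k; set rho := s ^+ k.+1 in dense *.
have k0 : (0 < k)%N by rewrite (leq_trans _ k12).
have lam1 : 1 < lam by rewrite sgt.
have rho1 : 1 < rho by rewrite sgt.
(* With eps lam <= kappa / 2, a covered cell has Mertens mass at least (2 - 1/8 - 1/8) (s - 1) / s
   >= 3/2 (s - 1), as s <= 9/8. *)
pose kappa := (s - 1) / 8.
have kap0 : 0 < kappa by rewrite /kappa; lra.
(* The number of covering blocks is chosen to beat the Mertens error 13 = 11 + 2. *)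
pose r := (Num.truncn (13 / (s - 1))).+1.
have rP : 13 < r%:R * (s - 1).
  by rewrite -ltr_pdivrMr ?subr_gt0 // truncnS_gt.
(* The last k + 1 cells make room for the window that starts at the largest admissible j. *)
pose J := (k + r * k.-1 + k.+1)%N.
exists (s ^+ J), (kappa * delta / rho), (kappa / (2 * lam)); split.
- by rewrite sgt // /J addnS.
- by rewrite divr_gt0 ?mulr_gt0 //; lra.
- by rewrite divr_gt0 // mulr_gt0; lra.
move=> eps T t0 x e0 ee0 T1 U Tt0 Xx.
have t00 : 0 < t0 by lra.
have tJ0 n : 0 < t0 * s ^+ n by rewrite mulr_gt0.
have x0 : 0 < x.
  have : 0 < x / (t0 * s ^+ J) by lra.
  by rewrite pmulr_lgt0 // invr_gt0.
rewrite leNgt; apply/negP => small.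
pose G i := exists t, [/\ t0 * s ^+ i <= t, t < t0 * s ^+ i.+1 & saturated lam kappa t].
have D0 n : x / (t0 * s ^+ J) < n%:R <= x / t0 -> 0 <= defect lam (eps * lam) x n.
  move=> /andP[n1 n2]; have n0 : (0 : R) < n%:R by apply: lt_trans n1; rewrite divr_gt0.
  apply: (defect_ge0 U lam1 T1); first by rewrite -(ltr0n R).
  apply: (le_trans Tt0); rewrite ler_pdivlMr // mulrC -ler_pdivlMr //.
have meet j : (j <= k + r * k.-1)%N -> exists i, (j <= i <= j + k)%N /\ G i.
  move=> jb; pose y := x / (t0 * s ^+ (j + k.+1)).
  have tj0 := tJ0 (j + k.+1)%N; have tj0' := tJ0 j.
  have yX : x / (t0 * s ^+ J) <= y.
    rewrite ler_pM2l // lef_pV2 ?posrE // ler_pM2l // ler_weXn2l //; first lra.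
    by rewrite /J leq_add2r.
  have y0 : 0 < y by lra.
  have ryE : rho * y = x / (t0 * s ^+ j).
    rewrite /y /rho exprD; field.
    by rewrite !gt_eqF // exprn_gt0.
  have ry : rho * y <= x / t0.
    rewrite ryE ler_pM2l // lef_pV2 ?posrE // ler_peMr //; lra.
  have xry : x / (rho * y) = t0 * s ^+ j.
    by rewrite ryE; field; rewrite !gt_eqF.
  have xy : x / y = t0 * s ^+ (j + k.+1).
    by rewrite /y; field; rewrite !gt_eqF.
  have := @saturated_exists lam kappa eps delta T x y rho U lam1 T1 kap0 (ltW e0).
  case.
  - lra.
  - by [].
  - by apply: dense; lra.
  - by rewrite xry (le_trans Tt0) // ler_peMr //; lra.
  - apply: le_lt_trans small.
    have yry : y <= rho * y by rewrite ler_peMl; lra.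
    rewrite (@sum_itv_split _ (x / (t0 * s ^+ J)) y (x / t0)) //; last lra.
    rewrite (@sum_itv_split _ y (rho * y) (x / t0)) //.
    have p1 : 0 <= sum_itv (x / (t0 * s ^+ J)) y (defect lam (eps * lam) x).
      apply: sum_itv_ge0; [lra|lra|move=> n /andP[n1 n2]].
      by apply: D0; rewrite n1 /=; lra.
    have p2 : 0 <= sum_itv (rho * y) (x / t0) (defect lam (eps * lam) x).
      apply: sum_itv_ge0; [lra|lra|move=> n /andP[n1 n2]].
      by apply: D0; rewrite n2 andbT; lra.
    lra.
  rewrite xry xy => t /andP[t1 t2] sat.
  (* The least such i is the index of the cell that contains t. *)
  have ext : exists i, t < t0 * s ^+ i.+1 by exists (j + k)%N; rewrite -addnS.
  case: (ex_minnP ext) => i ti imin.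
  exists i; split.
    apply/andP; split; last by apply: imin; rewrite -addnS.
    rewrite leqNgt; apply/negP => ij.
    have : t0 * s ^+ i.+1 <= t0 * s ^+ j by rewrite ler_pM2l // ler_weXn2l // ltW.
    lra.
  exists t; split => //.
  case: i imin ti => [|i] imin ti.
    by apply: le_trans t1; rewrite ler_pM2l // ler_weXn2l // ltW.
  by rewrite leNgt; apply/negP => /imin; rewrite ltnn.
pose w i := mertens (t0 * s ^+ i.+1) - mertens (t0 * s ^+ i).
have w0 i : 0 <= w i.
  rewrite /w mertens_sub; last by rewrite ler_pM2l // ler_weXn2l // ltW.
  by apply: sumr_ge0 => n _; rewrite divr_ge0 ?mangoldt_ge0.
pose a := 3 / 2 * (s - 1).
have a0 : 0 <= a by rewrite /a; lra.
have cov i i' : G i -> (i < i' < i + k)%N -> a <= w i'.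
  move=> [t [t1 t2 sat]] /andP[ii' i'k].
  have e : t0 * s ^+ i'.+1 = s * (t0 * s ^+ i') by rewrite exprS; ring.
  rewrite /w e.
  have tu : t <= t0 * s ^+ i'.
    by apply: (le_trans (ltW t2)); rewrite ler_pM2l // ler_weXn2l // ltW.
  have Tt : T <= t.
    by apply: le_trans t1; apply: (le_trans Tt0); rewrite ler_peMr //; lra.
  apply: le_trans (saturated_cell U s1 lam1 e0 T1 (ltW kap0) sat Tt tu _).
    have : eps * lam <= (s - 1) / 16.
      rewrite -ler_pdivlMr; last lra.
      apply: (le_trans ee0); rewrite /kappa invfM mulrA ler_pM2r ?invr_gt0; lra.
    have ss : (s - 1) * s <= (s - 1) * (9 / 8) by apply: ler_wpM2l; lra.
    move=> el16; rewrite ler_pdivlMr // /a /kappa -[2 * eps * lam]mulrA.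
    by move: (eps * lam) el16 => el el16; lra.
  rewrite -e; apply: (@le_trans _ _ (t0 * s ^+ (k + i))).
    by rewrite ler_pM2l // ler_weXn2l // ?ltW // addnC.
  by rewrite exprD mulrCA; apply: ler_wpM2l; [exact: ltW (sp k)|].
have := covered_blocks (r := r) a0 w0 k0 meet cov.
(* The masses telescope to at most r (k - 1) (s - 1) + 13, while the covering gives 3/2 (s - 1) (k -
   3) r. Hence r (s - 1) (k - 7) / 2 <= 13, impossible for k >= 12. *)
rewrite /w telescope_sumr ?leq_addr //.
set A := t0 * s ^+ (k + _); set B := t0 * s ^+ k.
have B1 : 1 <= B by rewrite /B; have := sge k; nra.
have AB : A = B * s ^+ (r * k.-1) by rewrite /A /B exprD mulrA.
have A1 : 1 <= A by rewrite AB; have := sge (r * k.-1)%N; nra.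
have /andP[_ mA] := mertens_bounds_real A1.
have /andP[mB _] := mertens_bounds_real B1.
rewrite AB lnM ?posrE ?lnXn // in mA; last lra.
have ls := ln_le_subr1 s0.
have K : k.-1%:R = k%:R - 1 :> R by rewrite -[in RHS](prednK k0) -natr1 addrK.
have K12 : (12 : R) <= k%:R by rewrite ler_nat.
rewrite -[ln s *+ _]mulr_natl natrM K in mA.
have r0 : (0 : R) <= r%:R by rewrite ler0n.
have : r%:R * (k%:R - 1) * ln s <= r%:R * (k%:R - 1) * (s - 1).
  by rewrite ler_wpM2l // mulr_ge0 //; lra.
rewrite -AB in mA.
rewrite /a => h1 h2.
have h3 : r%:R * (s - 1) * (1 / 2 * k%:R - 7 / 2) <= 13 by lra.
have : 13 * 1 < r%:R * (s - 1) * (1 / 2 * k%:R - 7 / 2).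
  apply: (@lt_le_trans _ _ (r%:R * (s - 1) * 1)); first by lra.
  by apply: ler_wpM2l; [apply: mulr_ge0|]; lra.
lra.
Qed.

(** Stacks the disjoint blocks with t0 = T H^i for i < B. *)
Lemma sum_defect_ge lam eps T H c X x : 1 < H -> 1 <= T -> 1 <= X -> 0 < x ->
  (forall t0, T <= t0 -> X <= x / (t0 * H) ->
    c * x <= sum_itv (x / (t0 * H)) (x / t0) (defect lam eps x)) ->
  forall B, X <= x / (T * H ^+ B) ->
  c * B%:R * x <= sum_itv (x / (T * H ^+ B)) (x / T) (defect lam eps x).
Proof.
move=> H1 T1 X1 x0 blk; elim=> [|B IH] hB.
  by rewrite expr0 mulr1 mulr0 mul0r /sum_itv big_geq.
have HB1 : 1 <= H ^+ B by rewrite exprn_ege1 // ltW.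
have HB0 : 0 < H ^+ B by lra.
have T0 : 0 < T by lra.
have TH0 : 0 < T * H ^+ B by rewrite mulr_gt0.
have e : T * H ^+ B.+1 = T * H ^+ B * H by rewrite exprSr mulrA.
have l1 : x / (T * H ^+ B * H) <= x / (T * H ^+ B).
  rewrite ler_pM2l // lef_pV2 ?posrE ?mulr_gt0 //; last lra.
  by rewrite ler_peMr //; lra.
have l2 : x / (T * H ^+ B) <= x / T.
  by rewrite ler_pM2l // lef_pV2 ?posrE // ler_peMr; lra.
rewrite e in hB *; rewrite (sum_itv_split _ l1 l2) -natr1.
have := blk (T * H ^+ B) _ hB; rewrite ler_peMr //; last lra.
move=> /(_ isT); have := IH (le_trans hB l1); lra.
Qed.

(** A discrete form of taking lam maximal: s^12 is sparse and high powers of s are not, by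
    [not_sparse_large], so some exponent k >= 12 is the last sparse one before a failure. *)
Lemma sparse_borderline lam : 1 < lam -> sparse lam ->
  exists s k, [/\ 1 < s, s <= 9 / 8, (12 <= k)%N, sparse (s ^+ k) & ~ sparse (s ^+ k.+1)].
Proof.
move=> lam_gt1 sp0.
pose mu := Num.min lam (9 / 8).
have mu1 : 1 < mu by rewrite lt_min lam_gt1 /=; lra.
have mu98 : mu <= 9 / 8 by rewrite ge_min lexx orbT.
have spmu : sparse mu by apply: sparse_le sp0; rewrite ge_min lexx.
have lmu0 : 0 < ln mu by rewrite ln_gt0.
have [s [s1 s12]] : exists s, 1 < s /\ s ^+ 12 = mu.
  exists (expR (ln mu / 12)); split; first by rewrite expR_gt1 divr_gt0.
  rewrite -expRM_natl mulrC divfK ?pnatr_eq0 // lnK // posrE; lra.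
have s98 : s <= 9 / 8.
  by apply: le_trans mu98; rewrite -s12 -[leLHS]expr1 ler_weXn2l // ltW.
have ls : 0 < ln s by rewrite ln_gt0.
exists s; apply: contrapT => noex.
have all_sp k : sparse (s ^+ (12 + k)).
  elim: k => [|k IH]; first by rewrite addn0 s12.
  rewrite addnS; apply: contrapT => ns; apply: noex.
  by exists (12 + k)%N; split => //; rewrite leq_addr.
pose K := (Num.truncn (14 / ln s)).+1.
have s0 : 0 < s by apply: lt_trans s1.
apply: (not_sparse_large _ _ (all_sp K)); first by rewrite exprn_gt0.
rewrite lnXn // -[ln s *+ _]mulr_natl -ler_pdivrMr //.
apply: (le_trans (ltW (truncnS_gt _))); by rewrite -/K ler_nat leq_addl.
Qed.

(** About ln x / ln H blocks, each with defect at least c x, exceed the total 3 eps la x ln x of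
    [sum_defect_le] once eps is small. *)
Lemma not_sparse_defect_block la X H c eps0 :
  1 < la -> 1 <= X -> 1 < H -> 0 < c -> 0 < eps0 ->
  (forall eps T t0 x,
    0 < eps -> eps <= eps0 -> 1 <= T -> short_interval_bound eps T -> T <= t0 ->
    X <= x / (t0 * H) ->
    c * x <= sum_itv (x / (t0 * H)) (x / t0) (defect la (eps * la) x)) ->
  ~ sparse la.
Proof.
move=> la1 X1 H1 c0 e00 blk spk.
have lH0 : 0 < ln H by rewrite ln_gt0.
(* The final comparison gives c <= 6 eps la ln H; the constant 12 makes this c <= c / 2, which is
   absurd. *)
have [eps [e0 ee0 ec]] : exists eps,
    [/\ 0 < eps, eps <= eps0 & eps * (12 * la * ln H) <= c].
  have K0 : 0 < 12 * la * ln H by rewrite !mulr_gt0 //; lra.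
  exists (Num.min eps0 (c / (12 * la * ln H))); split.
  - by rewrite lt_min e00 divr_gt0.
  - by rewrite ge_min lexx.
  - by rewrite -ler_pdivlMr // ge_min lexx orbT.
have [T T1 U] := short_interval_bound_exists e0.
have el0 : 0 < eps * la by rewrite mulr_gt0; lra.
have [X' defle] := sum_defect_le la1 el0 T1.
have TX1 : 1 <= T * X by rewrite (le_trans T1) // ler_peMr //; lra.
(* The exponential threshold yields B ln H >= ln x / 2; the last one gives x >= T X and ln x > 0. *)
have [x] := spk (eps * la)
  (Num.max X' (Num.max (expR (2 * (ln (T * X) + ln H))) (T * X * 2))) el0.
rewrite !ge_max => /and3P[xX' xM xTX] xsp.
have x0 : 0 < x by lra.
have lxM : 2 * (ln (T * X) + ln H) <= ln x by rewrite -[leLHS]expRK ler_ln ?posrE ?expR_gt0.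
have lx0 : 0 < ln x by rewrite ln_gt0; lra.
have [B [B1 B2]] : exists B : nat, B%:R * ln H <= ln x - ln (T * X) /\
    ln x - ln (T * X) < (B%:R + 1) * ln H.
  have z0 : 0 <= (ln x - ln (T * X)) / ln H.
    by rewrite divr_ge0 ?subr_ge0 ?ler_ln ?posrE //; lra.
  have /andP[B1 B2] := truncn_itv z0.
  exists (Num.truncn ((ln x - ln (T * X)) / ln H)).
  by rewrite -ler_pdivlMr // natr1 -ltr_pdivrMr.
have HB0 : 0 < H ^+ B by rewrite exprn_gt0; lra.
have T0 : 0 < T by lra.
have TH0 : 0 < T * H ^+ B by rewrite mulr_gt0.
have XB : X <= x / (T * H ^+ B).
  rewrite ler_pdivlMr // mulrA [X * T]mulrC -ler_ln ?posrE ?mulr_gt0 //; [|lra..].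
  rewrite lnM ?posrE; [|lra|lra].
  rewrite lnXn; last lra.
  by rewrite -[ln H *+ _]mulr_natl; lra.
have D0 n : 0 < n%:R :> R -> n%:R <= x / T -> 0 <= defect la (eps * la) x n.
  move=> n0 nx; apply: (defect_ge0 U la1 T1); first by rewrite -(ltr0n R).
  by rewrite ler_pdivlMr // mulrC -ler_pdivlMr.
have hge := sum_defect_ge H1 T1 X1 x0 (fun t0 => blk eps T t0 x e0 ee0 T1 U) XB.
have hle := defle x xX' xsp.
have xTB0 : 0 < x / (T * H ^+ B) by rewrite divr_gt0.
have xTB : x / (T * H ^+ B) <= x / T.
  rewrite ler_pM2l // lef_pV2 ?posrE // ler_peMr ?exprn_ege1 //; lra.
have : 0 <= sum_itv 0 (x / (T * H ^+ B)) (defect la (eps * la) x).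
  apply: sum_itv_ge0; [lra|lra|move=> n /andP[n1 n2]].
  by apply: D0 => //; lra.
rewrite (sum_itv_split _ (ltW xTB0) xTB) in hle.
move=> h0.
have h1 : c * B%:R * x <= 3 * (eps * la) * ln x * x by lra.
rewrite ler_pM2r // in h1.
have h2 : c * B%:R * ln H <= 3 * (eps * la) * ln x * ln H by rewrite ler_pM2r.
have h3 : c * (ln x / 2) <= c * (B%:R * ln H) by rewrite ler_pM2l //; lra.
have h4 : eps * (12 * la * ln H) * ln x <= c * ln x by rewrite ler_pM2r.
have h5 : 0 < c * ln x by rewrite mulr_gt0.
lra.
Qed.


Theorem not_sparse_gt1 lam : 1 < lam -> ~ sparse lam.
Proof.
move=> lam1 /(sparse_borderline lam1)[s [k [s1 s98 k12 spk nspk]]].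
have [delta [X [delta0 X1 dense]]] := not_sparse nspk.
have [H [c [eps0 [H1 c0 e00 blk]]]] := defect_block s1 s98 k12 delta0 X1 dense.
apply: (not_sparse_defect_block _ X1 H1 c0 e00 blk) spk.
by rewrite exprn_egt1 // -lt0n (leq_trans _ k12).
Qed.

End Erdos.

(** * Representations by two and by three coins *)

Section CoinProblem.
Local Open Scope ring_scope.

Lemma coprime_two_coin d e k n : (0 < d)%N -> (0 < e)%N -> coprime d e ->
  (d * e < k)%N -> (k + e * e <= e * n)%N ->
  exists y z, [/\ (0 < y)%N, (0 < z)%N, (y + z < n)%N & k = (d * y + e * z)%N].
Proof.
move=> d0 e0 cde dek ken; have /coprimeP := cde => /(_ d0)[[u1 u2] /= u12].
have ue : (u1 * d = u2 * e + 1)%N by lia.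
have k0 : (0 < k)%N by lia.
have u1k0 : (0 < u1 * k)%N by rewrite muln_gt0 k0 andbT; case: u1 ue {u12} => //; lia.
(* [u1] inverts d modulo e, and the shift by one picks the residue of u1 k in 1..e, so that y > 0.
   Then d y <= d e < k forces z > 0. *)
pose y := ((u1 * k).-1 %% e).+1.
have ye : (y <= e)%N by rewrite /y ltn_mod.
have dyde : (d * y <= d * e)%N by rewrite leq_mul2l ye orbT.
have ymod : y = u1 * k %[mod e] by rewrite /y -addn1 modnDml addn1 prednK.
have /dvdnP[z zE] : (e %| k - d * y)%N.
  rewrite -eqn_mod_dvd; last by lia.
  rewrite eq_sym -modnMmr ymod modnMmr mulnA [(d * u1)%N]mulnC ue mulnDl mul1n.
  by rewrite mulnAC modnMDl.
exists y, z; rewrite /y ltnS leq0n -/y; split => //.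
- by case: z zE => //; lia.
- have dy0 : (0 < d * y)%N by rewrite muln_gt0 d0.
  have : (z + e < n)%N by rewrite -(ltn_pmul2l e0) mulnDr [(e * z)%N]mulnC -zE; lia.
  by move=> zen; apply: leq_ltn_trans zen; rewrite addnC leq_add2l.
- by rewrite [(e * z)%N]mulnC; lia.
Qed.

(** Setting x = n - y - z reduces the equation to q - a n = d y + e z. The bounds are doubled to
    avoid halves. *)
Lemma three_coin a d e n q : (0 < d)%N -> (0 < e)%N -> coprime d e ->
  (2 * (e * e + 2 * (d * e)) < n)%N -> (a * n + d * e < q)%N ->
  (2 * q <= 2 * (a * n + d * e) + n + d * e)%N ->
  exists x y z, [/\ (0 < x)%N, (0 < y)%N & (0 < z)%N] /\ n = (x + y + z)%N /\
    (a * x + (a + d) * y + (a + e) * z)%N = q.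
Proof.
move=> d0 e0 cde nlarge q1 q2.
have en : (n <= e * n)%N by rewrite leq_pmull.
have [|| y [z [y0 z0 yzn qE]]] := @coprime_two_coin d e (q - a * n) n d0 e0 cde.
- lia.
- lia.
have [x x0 nE] : exists2 x, (0 < x)%N & n = (x + y + z)%N.
  by exists (n - y - z)%N; lia.
exists x, y, z; split => //; split => //.
have -> : q = (a * n + (d * y + e * z))%N by lia.
rewrite nE; ring.
Qed.

End CoinProblem.

(** * Primes and prime powers in short intervals, and the conclusion *)

Section PrimesInShortIntervals.
Local Open Scope ring_scope.
Variable R : realType.

(** A proper prime power up to N has base at most sqrt N, and the powers of one p contribute at most
    [trunc_log p N] times ln p, which is at most ln N. *)
Lemma sum_mangoldt_nonprime_le N : (0 < N)%N ->
  \sum_(1 <= n < N.+1 | ~~ prime n) mangoldt R n <= Num.sqrt N%:R * ln N%:R.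
Proof.
move=> N0; set s := Num.truncn (Num.sqrt (N%:R : R)).
have lN : 0 <= ln (N%:R : R) by rewrite ln_ge0 // ler1n.
pose F n := \sum_(1 <= p < s.+1) \sum_(1 <= k < (trunc_log p N).+1)
  (n == (p ^ k)%N)%:R * ln p%:R : R.
have F0 n : 0 <= F n.
  rewrite /F big_nat; apply: sumr_ge0 => p /andP[p1 _]; apply: sumr_ge0 => k _.
  by rewrite mulr_ge0 // ln_ge0 // ler1n.
apply: (@le_trans _ _ (\sum_(1 <= n < N.+1) F n)).
  rewrite big_mkcond big_nat [leRHS]big_nat; apply: ler_sum => n; rewrite ltnS => /andP[n0 nN].
  case: ifP => // npr.
  have [->//|/mangoldt_neq0[p [k [pp k0 nE]]]] := eqVneq (mangoldt R n) 0.
  have k2 : (1 < k)%N.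
    by rewrite ltn_neqAle k0 andbT; apply/eqP => k1; rewrite nE -k1 expn1 pp in npr.
  have p1 := prime_gt1 pp.
  have ps : (p <= s)%N.
    rewrite truncn_ge_nat ?sqrtr_ge0 // -(ger0_norm (ler0n R p)) -sqrtr_sqr.
    rewrite ler_wsqrtr // -natrX ler_nat (leq_trans _ nN) // nE.
    by rewrite leq_exp2l.
  have kl : (k <= trunc_log p N)%N by rewrite trunc_log_max // -nE.
  rewrite nE mangoldt_pfactor // /F (bigD1_seq p) ?iota_uniq ?mem_index_iota ?(ltnW p1) //=.
  rewrite (bigD1_seq k) ?iota_uniq ?mem_index_iota ?k0 //= eqxx mul1r -addrA lerDl.
  rewrite addr_ge0 // big_seq_cond; apply: sumr_ge0.
    by move=> j _; rewrite mulr_ge0 // ln_ge0 // ler1n ltnW.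
  move=> q; rewrite mem_index_iota => /andP[/andP[q1 _] _].
  by apply: sumr_ge0 => j _; rewrite mulr_ge0 // ln_ge0 // ler1n.
rewrite /F exchange_big /=.
apply: (@le_trans _ _ (\sum_(1 <= p < s.+1) ln N%:R)); last first.
  rewrite sumr_const_nat subn1 /= -[ln _ *+ _]mulr_natl ler_wpM2r //.
  by rewrite truncn_le sqrtr_ge0.
rewrite big_nat [leRHS]big_nat; apply: ler_sum => p; rewrite ltnS => /andP[p1 ps].
have lp : 0 <= ln (p%:R : R) by rewrite ln_ge0 // ler1n.
rewrite exchange_big /=.
apply: (@le_trans _ _ (\sum_(1 <= k < (trunc_log p N).+1) ln p%:R)).
  apply: ler_sum => k _; rewrite -mulr_suml ler_piMl //; exact: sum_nat_eq_le1.
rewrite sumr_const_nat subn1 /=.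
have [p2|p2] := ltnP 1 p; last first.
  have -> : p = 1%N by apply/eqP; rewrite eqn_leq p2.
  by rewrite ln1 mul0rn.
rewrite -lnXn ?ltr0n // ler_ln ?posrE ?exprn_gt0 ?ltr0n // -natrX ler_nat.
exact: trunc_logP.
Qed.

Lemma prime_in_short_interval (rho : R) : 1 < rho ->
  exists X : R, forall x, X <= x -> exists p, prime p /\ x < p%:R <= rho * x.
Proof.
move=> rho1; have [delta [X [delta0 X1 dense]]] := not_sparse (not_sparse_gt1 rho1).
(* Without a prime in the interval, delta y <= 4 rho y^(3/4), that is y <= M^4. *)
pose M := 4 * rho / delta.
have M0 : 0 < M by rewrite divr_gt0 // mulr_gt0 //; lra.
exists (X + M ^+ 4) => x Xx.
have M40 : 0 < M ^+ 4 by rewrite exprn_gt0.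
have x1 : 1 <= x by lra.
have xr : x <= rho * x by rewrite ler_peMl; lra.
apply: contrapT => nop.
have h := dense x ltac:(lra).
set y := rho * x in xr h.
have y1 : 1 <= y by lra.
have [n0 n1 ny _ _] := truncn_bounds y1.
have up : psi y - psi x <= Num.sqrt y * ln y.
  apply: (@le_trans _ _ (\sum_(1 <= n < (Num.truncn y).+1 | ~~ prime n) mangoldt R n)).
    rewrite psi_sub // (big_cat_nat (n := (Num.truncn x).+1)) //=; last first.
      by rewrite ltnS le_truncn.
    rewrite -[leLHS]add0r; apply: lerD.
      by apply: sumr_ge0 => n _; exact: mangoldt_ge0.
    rewrite /sum_itv [leRHS]big_mkcond [leLHS]big_nat [leRHS]big_nat.
    apply: ler_sum => n; rewrite mem_sum_itv; [|lra|lra] => nxy.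
    by case: ifPn => // /negPn pn; case: nop; exists n.
  apply: (le_trans (sum_mangoldt_nonprime_le n0)).
  rewrite ler_pM ?sqrtr_ge0 ?ln_ge0 ?ler_wsqrtr ?ler_ln ?posrE //; lra.
set s := Num.sqrt y in up.
have s1 : 1 <= s by rewrite -(@sqrtr1 R) ler_wsqrtr.
have ys : y = s * s by rewrite -expr2 sqr_sqrtr //; lra.
have ly := ln_le_sqrt_sqrt y1; rewrite -/s in ly.
set t := Num.sqrt s in ly.
have t1 : 1 <= t by rewrite -(@sqrtr1 R) ler_wsqrtr.
have st : s = t * t by rewrite -expr2 sqr_sqrtr //; lra.
have k1 : delta * y <= rho * (s * (4 * t)).
  have -> : delta * y = rho * (delta * x) by rewrite /y; ring.
  apply: ler_wpM2l; first lra.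
  apply: (le_trans h); apply: (le_trans up); apply: ler_wpM2l => //; lra.
have s0 : 0 < s * t by rewrite mulr_gt0; lra.
have tM : t <= M.
  rewrite ler_pdivlMr // -(ler_pM2l s0).
  by move: k1; rewrite ys st; lra.
have yM : y <= M ^+ 4.
  have -> : y = t ^+ 4 by rewrite ys st; ring.
  by rewrite lerXn2r ?nnegrE //; lra.
lra.
Qed.

(** Apply the case of primes to the m-th roots of tau and y. *)
Lemma prime_power_in_short_interval (tau : R) m : 1 < tau -> (0 < m)%N ->
  exists Y : R, forall y, Y <= y -> exists p, prime p /\ y < (p ^ m)%:R <= tau * y.
Proof.
move=> tau1 m0.
have m0' : (0 : R) < m%:R by rewrite ltr0n.
have root (z : R) : 0 < z -> exists2 u, 0 < u & u ^+ m = z.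
  move=> z0; exists (expR (ln z / m%:R)); first exact: expR_gt0.
  by rewrite -expRM_natl mulrC divfK ?gt_eqF // lnK.
have [rho rho0 rhoE] := root tau ltac:(lra).
have rho1 : 1 < rho.
  by rewrite -(ltr_pXn2r m0) ?nnegrE ?(ltW rho0) // rhoE expr1n.
have [X HX] := prime_in_short_interval rho1.
pose Z := Num.max 1 X.
have Z1 : 1 <= Z by rewrite le_max lexx.
have Z0 : 0 < Z ^+ m by rewrite exprn_gt0; lra.
exists (Z ^+ m) => y Zy.
have [x x0 xE] := root y ltac:(lra).
have Zx : Z <= x.
  by rewrite -(ler_pXn2r m0) ?nnegrE ?xE //; lra.
have [|p [pp /andP[xp px]]] := HX x.
  by apply: le_trans Zx; rewrite le_max lexx orbT.
exists p; split => //; rewrite natrX -xE -rhoE -exprMn.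
by rewrite ltr_pXn2r ?ler_pXn2r ?nnegrE ?mulr_ge0 ?(ltW x0) ?(ltW rho0) ?xp.
Qed.

Lemma prime_power_three_coin a b c m : (0 < a)%N -> (0 < m)%N -> (a < b)%N ->
  (b <= c)%N -> gcdn (b - a) (c - a) = 1%N ->
  exists N : nat, (0 < N)%N /\
    forall n : nat, (N <= n)%N ->
      exists x y z : nat,
        [/\ (0 < x)%N, (0 < y)%N & (0 < z)%N] /\
        n = (x + y + z)%N /\
        exists p : nat, prime p /\ (a * x + b * y + c * z = p ^ m)%N.
Proof.
move=> ha hm hab hbc hgcd.
pose d := (b - a)%N; pose e := (c - a)%N.
have d0 : (0 < d)%N by rewrite subn_gt0.
have e0 : (0 < e)%N by rewrite subn_gt0 (leq_trans hab).
have a0 : (0 : R) < a%:R by rewrite ltr0n.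
(* At y = a n + d e this ratio allows an excess of at most (n + d e) / 2, as [three_coin]
   requires. *)
have tau1 : 1 < 1 + (2 * a%:R)^-1 :> R by rewrite ltrDl invr_gt0 mulr_gt0.
have [Y HY] := prime_power_in_short_interval tau1 hm.
(* The first summand puts a n + d e above Y, the second is the size condition of [three_coin]. *)
exists (Num.truncn Y + 2 * (e * e + 2 * (d * e))).+1; split => // n Nn.
have nY : Y <= (a * n + d * e)%:R.
  apply: (le_trans (ltW (truncnS_gt Y))); rewrite ler_nat.
  apply: (leq_ltn_trans (leq_addr _ _) (leq_trans Nn _)).
  by rewrite (leq_trans (leq_pmull n ha)) // leq_addr.
have [p [pp /andP[p1 p2]]] := HY _ nY.
rewrite ltr_nat in p1.
have p3 : (2 * p ^ m <= 2 * (a * n + d * e) + n + d * e)%N.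
  rewrite -(ler_nat R).
  have -> : (2 * (a * n + d * e) + n + d * e)%:R =
     2 * ((a * n + d * e)%:R + (2 * a%:R)^-1 * (a%:R * (n + d * e)%:R)) :> R.
    by rewrite -addnA natrD natrM; field; rewrite gt_eqF.
  rewrite natrM ler_pM2l //; apply: (le_trans p2).
  rewrite mulrDl mul1r lerD2l ler_wpM2l ?invr_ge0 ?mulr_ge0 // ?(ltW a0) //.
  by rewrite -natrM ler_nat mulnDr leq_add2l leq_pmull.
have cde : coprime d e by rewrite /coprime hgcd.
have [|x [y [z [xyz0 [nE xyzE]]]]] := three_coin d0 e0 cde _ p1 p3.
  by apply: leq_ltn_trans Nn; rewrite leq_addl.
exists x, y, z; split => //; split => //; exists p; split => //.
rewrite -xyzE /d /e !subnKC // ltnW // (leq_trans hab) //.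
Qed.

End PrimesInShortIntervals.

Theorem theorem1p2 (a b c m : nat) (ha : 0 < a) (hb : 0 < b) (hc : 0 < c)
    (hm : 0 < m) (hab : a < b) (hbc : b <= c)
    (hgcd : gcdn (b - a) (c - a) = 1) :
  exists N : nat, 0 < N /\
    forall n : nat, N <= n ->
      exists x y z : nat,
        [/\ 0 < x, 0 < y & 0 < z] /\
        n = x + y + z /\
        exists p : nat, prime p /\ a * x + b * y + c * z = p ^ m.
Proof.
exact: (prime_power_three_coin Rdefinitions.R ha hm hab hbc hgcd).
Qed.
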